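(* Let $T_i$ ($i=1,2,\dots$) and $T$ be compactly supported $n$-currents in $\mathbb{R}^N$ with finite mass, and let $T_i\rightharpoonup T$ weakly and $\|T_i\|(\mathbb{R}^N)\to\|T\|(\mathbb{R}^N)$. Then for every $k\in\{1,2,\dots\}$, $$\limsup_{i\to\infty}\lambda_k(T_i)\le\lambda_k(T),$$ where, for an $n$-current $S$ of finite, compactly supported mass, $$\lambda_k(S)=\inf_{\Lambda^k\subset C^\infty(\mathbb{R}^N)}\ \sup_{f\in\Lambda^k\setminus\{0\}}\frac{\int|\nabla f|^2\,d\|S\|}{\int|f|^2\,d\|S\|},$$ the infimum being over all $k$-dimensional linear subspaces $\Lambda^k$ of $C^\infty(\mathbb{R}^N)$.
   Context: Here $n\le N$. An $n$-current on $\mathbb{R}^N$ is a continuous linear functional $T$ on the space $\mathcal{D}_n$ of smooth, compactly supported differential $n$-forms on $\mathbb{R}^N$. Weak convergence $T_i\rightharpoonup T$ means $T_i(\phi)\to T(\phi)$ for all $\phi\in\mathcal{D}_n$. For open $O\subset\mathbb{R}^N$, $\|T\|(O)=\sup\{T(\phi) : \phi\in\mathcal{D}_n,\ \|\phi\|\le 1,\ \mathrm{supp}(\phi)\subset O\}$, where the condition $\|\phi\|\le1$ means that at every point the comass $\|\phi\|=\sup\{\langle\xi,\phi\rangle : \xi \text{ a simple } n\text{-vector},\ |\xi|\le 1\}$ is at most $1$. $T$ has finite mass if $\|T\|(\mathbb{R}^N)<\infty$; then $\|T\|$ extends to a Radon measure on $\mathbb{R}^N$, also denoted $\|T\|$.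 Here $\nabla f$ is the Euclidean gradient in $\mathbb{R}^N$. By convention the quotient $\int|\nabla f|^2\,d\|S\|\,/\int|f|^2\,d\|S\|$ equals $\infty$ when $f=0$ $\|S\|$-almost everywhere. Thus $\lambda_k(S)\in[0,\infty]$. *)

(* Defs.v *)
(* R^N is 'rV[R]_N, whose library topology is the usual one (its library norm is the
   max norm; Euclidean norms are written out below). *)
From HB Require Import structures.
From mathcomp Require Import all_boot all_order all_algebra.
From mathcomp Require Import all_classical all_reals all_analysis.

Set Implicit Arguments.
Unset Strict Implicit.
Unset Printing Implicit Defensive.

Import Order.TTheory GRing.Theory Num.Theory.
Import numFieldNormedType.Exports.

Local Open Scope classical_set_scope.
Local Open Scope ring_scope.

Section SmoothFunctions.
Variables (R : realType) (N : nat).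
Implicit Types (f g : 'rV[R]_N -> R^o) (s : seq 'I_N).

Definition partial (i : 'I_N) f : 'rV[R]_N -> R^o :=
  fun x => 'D_(delta_mx 0 i) f x.

Definition iter_partial s f : 'rV[R]_N -> R^o := foldr partial f s.

(* f is C^infinity: all iterated partial derivatives, of all orders, exist and
   are continuous.  'D is total, whence the explicit derivability clause. *)
Definition smooth f := forall s,
  continuous (iter_partial s f) /\
  forall i x, derivable (iter_partial s f) x (delta_mx 0 i).

Definition gradient f (x : 'rV[R]_N) : 'rV[R]_N := \row_i partial i f x.

Lemma iter_partial_lin (a : R) f g s : smooth f -> smooth g ->
  iter_partial s (a *: f + g) = a *: iter_partial s f + iter_partial s g.
Proof.
move=> sf sg; elim: s => [//|i s ih] /=.
rewrite ih; apply/funext => x; rewrite /partial.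
have [_ /(_ i x) df] := sf s; have [_ /(_ i x) dg] := sg s.
by rewrite deriveD ?deriveZ//; exact: derivableZ.
Qed.

Lemma smooth_lin (a : R) f g : smooth f -> smooth g -> smooth (a *: f + g).
Proof.
move=> sf sg s; rewrite iter_partial_lin//.
have [cf df] := sf s; have [cg dg] := sg s; split=> [x|i x].
  apply: (@continuousD _ _ _ (a *: iter_partial s f) (iter_partial s g) x).
    exact: (@continuousZl_tmp _ _ _ (iter_partial s f) a x (cf x)).
  exact: cg.
exact: (derivableD (derivableZ (df i x)) (dg i x)).
Qed.

Lemma smooth0 : smooth (0 : 'rV[R]_N -> R^o).
Proof.
have E s : iter_partial s (0 : 'rV[R]_N -> R^o) = 0.
  elim: s => [//|i s /= ->]; apply/funext => x.
  exact: (derive_cst (0 : R^o)).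
move=> s; rewrite E; split=> [x|i x]; first exact: cst_continuous.
exact: (derivable_cst (0 : R^o)).
Qed.

End SmoothFunctions.

Section Multivectors.
Variables (R : realType) (N n : nat).

(* Strictly increasing I : {0..n-1} -> {0..N-1}. *)
Definition multi_index :=
  {I : {ffun 'I_n -> 'I_N} |
    [forall i : 'I_n, forall j : 'I_n, (i < j)%N ==> (I i < I j)%N]}.

(* An n-vector is given by its coordinates on the e_I = e_I(0) /\.../\ e_I(n-1),
   an n-covector by its coordinates on the dual basis dx_I. *)
Definition nvector := {ffun multi_index -> R^o}.
Definition ncovector := {ffun multi_index -> R^o}.

Definition pairing (xi : nvector) (w : ncovector) : R := \sum_I xi I * w I.

Definition nvector_norm (xi : nvector) : R := Num.sqrt (\sum_I xi I ^+ 2).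

(* v_0 /\ ... /\ v_(n-1), where v_i is the i-th row of V: its coordinates are
   the maximal minors of V. *)
Definition wedge (V : 'M[R]_(n, N)) : nvector :=
  [ffun I : multi_index => (\det (colsub (sval I) V) : R^o)].

(* The scalar c is redundant unless n = 0, where wedge V is always 1 and all
   scalars count as simple. *)
Definition simple_nvector : set nvector :=
  [set xi | exists (c : R) (V : 'M[R]_(n, N)), xi = c *: wedge V].

Definition comass (w : ncovector) : \bar R :=
  ereal_sup [set (pairing xi w)%:E |
    xi in [set xi | simple_nvector xi /\ nvector_norm xi <= 1]].

End Multivectors.

Section TestForms.
Variables (R : realType) (N n : nat).

Definition form_support (w : 'rV[R]_N -> ncovector R N n) : set 'rV[R]_N :=
  closure [set x | w x != 0].

Definition form_coef (w : 'rV[R]_N -> ncovector R N n)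
  (I : multi_index N n) : 'rV[R]_N -> R^o := fun x => w x I.

Definition is_test_form : {pred ('rV[R]_N -> ncovector R N n)} :=
  fun w => `[< (forall I, smooth (form_coef w I)) /\
               compact (form_support w) >].

Lemma is_test_form_submod : submod_closed is_test_form.
Proof.
split=> [|a v w /asboolP[sv cv] /asboolP[sw cw]]; apply/asboolP; split.
- move=> I; rewrite (_ : form_coef _ _ = 0); first exact: smooth0.
  by apply/funext => x; rewrite /form_coef ffunE.
- rewrite /form_support (_ : [set _ | _] = set0).
    by rewrite closure0; exact: compact0.
  by rewrite -subset0 => x /=; rewrite eqxx.
- move=> I; rewrite (_ : form_coef _ _ = a *: form_coef v I + form_coef w I).
    exact: smooth_lin.
  by apply/funext => x; rewrite /form_coef !ffunE.
- apply: (@subclosed_compact _ _ (form_support v `|` form_support w)).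
  + exact: closed_closure.
  + exact: compactU.
  + rewrite /form_support -closureU; apply: closure_subset => x /= nz.
    have [vx|] := eqVneq (v x) 0; last by left.
    right; apply: contra_neq nz => wx.
    by rewrite -[LHS]/(a *: v x + w x) vx wx scaler0 addr0.
Qed.

HB.instance Definition _ :=
  GRing.isSubmodClosed.Build R ('rV[R]_N -> ncovector R N n) is_test_form
    is_test_form_submod.

(* The space D_n of smooth compactly supported n-forms. *)
Record test_form := TestForm {
  form_val :> 'rV[R]_N -> ncovector R N n;
  _ : form_val \in is_test_form }.

HB.instance Definition _ := [isSub for form_val].
HB.instance Definition _ := [Choice of test_form by <:].
HB.instance Definition _ := [SubChoice_isSubLmodule of test_form by <:].

(* Distance at most e, uniformly on R^N, of all derivatives of order <= m. *)
Definition Cm_close (m : nat) (e : R) (v w : test_form) := forall s I x,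
  (size s <= m)%N ->
  `|iter_partial s (form_coef v I) x - iter_partial s (form_coef w I) x| <= e.

(* The topology of D_n: for each compact K the forms supported in K carry the
   topology of uniform convergence of all derivatives, and D_n has the largest
   topology making all the inclusions continuous.  For linear functionals,
   continuity is the same as for the locally convex inductive limit topology. *)
Definition open_test_form : set_system test_form := fun U =>
  forall K : set 'rV[R]_N, compact K ->
  forall v : test_form, U v -> form_support v `<=` K ->
  exists (m : nat) (e : R), 0 < e /\
    forall w : test_form, form_support w `<=` K -> Cm_close m e v w -> U w.

Lemma open_test_formT : open_test_form setT.
Proof. by move=> K _ v _ _; exists 0%N, 1; split=> //; exact: ltr01. Qed.

Lemma open_test_formI : setI_closed open_test_form.
Proof.
move=> U V oU oV K cK v [Uv Vv] vK.
have [m [e [e0 Um]]] := oU K cK v Uv vK.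
have [p [d [d0 Vp]]] := oV K cK v Vv vK.
exists (maxn m p), (Num.min e d); split; first by rewrite lt_min e0.
move=> w wK vw; split.
  apply: Um => // s I x sm; apply: le_trans (vw s I x _) _.
    by rewrite leq_max sm.
  by rewrite ge_min lexx.
apply: Vp => // s I x sp; apply: le_trans (vw s I x _) _.
  by rewrite leq_max sp orbT.
by rewrite ge_min lexx orbT.
Qed.

Lemma open_test_form_bigU (J : Type) (F : J -> set test_form) :
  (forall j, open_test_form (F j)) -> open_test_form (\bigcup_j F j).
Proof.
move=> oF K cK v [j _ Fv] vK; have [m [e [e0 Fm]]] := oF j K cK v Fv vK.
by exists m, e; split=> // w wK vw; exists j => //; exact: Fm.
Qed.

HB.instance Definition _ := isOpenTopological.Build test_form
  open_test_formT open_test_formI open_test_form_bigU.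

End TestForms.

Record current (R : realType) (N n : nat) := Current {
  current_val :> {scalar test_form R N n};
  current_continuous : continuous (current_val : test_form R N n -> R) }.

Section Currents.
Variables (R : realType) (N n : nat).
Implicit Types S : current R N n.

Definition current_support S : set 'rV[R]_N :=
  [set x | forall U : set 'rV[R]_N, open U -> U x ->
    exists2 w : test_form R N n, form_support w `<=` U & S w != 0].

Definition mass_open S (O : set 'rV[R]_N) : \bar R :=
  ereal_sup [set (S w)%:E | w in [set w : test_form R N n |
    (forall x, (comass (w x) <= 1)%E) /\ form_support w `<=` O]].

Definition finite_mass S := (mass_open S setT < +oo)%E.

(* The extension of mass_open to arbitrary subsets by outer regularity.  For S
   of finite mass this is an outer measure, finite and countably additive on
   Borel sets, and hence the Radon measure ||S||. *)
Definition mass S (A : set 'rV[R]_N) : \bar R :=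
  ereal_inf [set mass_open S O | O in [set O | open O /\ A `<=` O]].

End Currents.

Section Eigenvalues.
Variables (R : realType) (N n : nat).
Implicit Types S : current R N n.

Local Notation borelRN := (g_sigma_algebraType (@open 'rV[R]_N)).

Definition sqr_norm (v : 'rV[R]_N) : R := \sum_i v 0 i ^+ 2.

Definition mass_integral S (g : 'rV[R]_N -> R) : \bar R :=
  (\int[mass S : set borelRN -> \bar R]_(x in setT) (g x)%:E)%E.

Definition rayleigh S (f : 'rV[R]_N -> R^o) : \bar R :=
  if `[< mass S [set x | f x != 0] = 0%E >] then +oo%E
  else (mass_integral S (fun x => sqr_norm (gradient f x)) /
        mass_integral S (fun x => (`|f x| ^+ 2)%R))%E.

(* L is a k-dimensional linear subspace of C^infinity(R^N): the span of k
   linearly independent smooth functions. *)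
Definition smooth_subspace (k : nat) (L : set ('rV[R]_N -> R^o)) :=
  exists b : 'I_k -> 'rV[R]_N -> R^o,
  [/\ forall j, smooth (b j),
      forall c : 'I_k -> R, \sum_j c j *: b j = 0 -> forall j, c j = 0
    & L = [set \sum_j c j *: b j | c in [set: 'I_k -> R]]].

Definition lambda (k : nat) S : \bar R :=
  ereal_inf [set ereal_sup [set rayleigh S f | f in L `\ 0] |
    L in smooth_subspace k].

End Eigenvalues.

(* Main.v *)
From HB Require Import structures.
Require Import Defs.
From mathcomp Require Import all_boot all_order all_algebra.
From mathcomp Require Import all_classical all_reals all_analysis.
From mathcomp Require Import measurable_realfun finmap ring lra.
Import Order.TTheory GRing.Theory Num.Theory.
Import numFieldNormedType.Exports.
Set Implicit Arguments.
Unset Strict Implicit.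
Unset Printing Implicit Defensive.
Local Open Scope classical_set_scope.
Local Open Scope ring_scope.

(* ||S|| is an outer measure, since smooth cutoffs split a form supported in a
   union of open sets, and a Borel measure, since open sets satisfy Caratheodory's
   criterion.  Weak convergence makes ||T_i|| lower semicontinuous on open sets,
   so convergence of the total masses gives convergence of the integrals of
   bounded continuous functions.
   Given a competitor space for lambda_k(T) with Rayleigh quotients below c,
   multiply a basis of it by a smooth compactly supported cutoff equal to 1 near
   the support of T.  This changes no quotient for T, and for the new basis (g_j)
   the Gram matrices B = (int g_j g_l) and A = (int grad g_j . grad g_l) converge.
   Both B and c B - A are positive definite for T, hence for T_i with i large, so
   that the span of (g_j) is a competitor for lambda_k(T_i) with quotients <= c. *)

(** * Smooth cutoff functions *)

Section ChainRule.
Context {R : realType} {V : normedModType R}.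

(** Restricting to a line turns a directional derivative into a derivative in one real variable,
    where the chain rule [derive1_comp] applies. *)
Lemma derive_line (f : V -> R^o) x v :
  'D_v f x = 'D_1 (fun t : R => f (t *: v + x)) 0.
Proof.
rewrite /derive; set g1 := fun h => h^-1 *: _; set g2 := fun h => h^-1 *: _.
suff -> : g1 = g2 by [].
apply/funext => h; rewrite /g1 /g2 /=.
by rewrite addr0 scale0r add0r [_%:A]mulr1.
Qed.

Lemma is_derive_comp1 (f : V -> R^o) (h : R -> R^o) x v (a b : R) :
  is_derive x v f a -> is_derive (f x) 1 h b ->
  is_derive x v (fun y => h (f y)) (b * a).
Proof.
move=> [df <-] [dh <-].
have f0 : f (0 *: v + x) = f x by rewrite scale0r add0r.
have dg : derivable (fun t : R => f (t *: v + x)) 0 1 by exact/(derivable1P f x v).1.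
have dhg : derivable h (f (0 *: v + x)) 1 by rewrite f0.
split.
  apply/(derivable1P (fun y => h (f y)) x v).2/derivable1_diffP.
  apply: (@differentiable_comp _ _ _ _ (fun t : R => f (t *: v + x)) h).
    exact/derivable1_diffP.
  exact/derivable1_diffP.
rewrite !derive_line -!derive1E.
have := @derive1_comp R (fun t : R => f (t *: v + x)) h 0 dg dhg.
by rewrite /comp => ->; rewrite f0 derive1E.
Qed.

End ChainRule.

(** * The functions exp(-1/t) / t^m, extended by 0, and their derivatives *)

Section Flat.
Context {R : realType}.

Definition flat (m : nat) (t : R) : R :=
  if 0 < t then t^-1 ^+ m * expR (- t^-1) else 0.

Lemma flat_ge0 m t : 0 <= flat m t.
Proof.
rewrite /flat; case: ifPn => // t0.
by rewrite mulr_ge0 ?expR_ge0// exprn_ge0// invr_ge0 ltW.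
Qed.

Lemma flat_gt0 m t : (0 < flat m t) = (0 < t).
Proof.
rewrite /flat; case: ifPn => t0; last by rewrite ltxx.
by rewrite mulr_gt0 ?expR_gt0// exprn_gt0// invr_gt0.
Qed.

Lemma flat_le0 m t : t <= 0 -> flat m t = 0.
Proof. by rewrite /flat ltNge => ->. Qed.

(** The exponential dominates a single term of its series: exp(1/t) is at least t^-(m+1) / (m+1)!.
    This linear bound controls the difference quotients at 0. *)
Lemma flat_le m t : 0 <= t -> flat m t <= m.+1`!%:R * t.
Proof.
move=> t0; rewrite /flat; case: ifPn => [{}t0|_]; last by rewrite mulr_ge0.
have i0 : 0 <= t^-1 by rewrite invr_ge0 ltW.
have := @expR_ge1Dxn R t^-1 m i0; set F := _%:R => h.
have F0 : 0 < F by rewrite /F ltr0n fact_gt0.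
rewrite expRN ler_pdivrMr ?expR_gt0//.
have : t^-1 ^+ m.+1 / F <= expR t^-1 by apply: le_trans h; rewrite lerDr.
rewrite ler_pdivrMr// => {}h.
have -> : t^-1 ^+ m = t * t^-1 ^+ m.+1.
  by rewrite exprS mulrA divff ?mul1r// gt_eqF.
by rewrite [F * t]mulrC -mulrA ler_wpM2l ?(ltW t0)// mulrC.
Qed.

(* The family flat m is stable under differentiation up to linear combinations,
   which is what makes smooth_alg below stable under partial derivatives. *)
Lemma is_derive_flat m t :
  is_derive t (1 : R) (flat m) (- m%:R * flat m.+1 t + flat m.+2 t).
Proof.
have [t0|t0|->] := ltgtP t 0.
- rewrite !flat_le0 ?(ltW t0)// mulr0 addr0.
  apply: (@near_eq_is_derive R R R (cst 0)).
  near=> s; rewrite /cst flat_le0//; near: s.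
  by apply: filterS (lt_nbhsl t0) => s st; exact: ltW.
- apply: (@near_eq_is_derive R R R (fun s : R => s^-1 ^+ m * expR (- s^-1))).
    near=> s; rewrite /flat ifT//; near: s.
    exact: lt_nbhsr.
  have tn0 : t != 0 by rewrite gt_eqF.
  have di : is_derive t (1 : R) (fun s : R => s^-1) (- t ^- 2).
    by apply: is_derive_eq (is_deriveV _ _) _ => //; rewrite [LHS]mulr1.
  have dN := is_deriveN di.
  have dX := is_deriveX m di.
  have dE := @is_derive_comp1 R R _ (@expR R) t 1 _ _ dN (is_derive_expR _).
  have dM := is_deriveM dX dE.
  rewrite (_ : (fun s => s^-1 ^+ m * expR (- s^-1)) =
      (fun s : R => s^-1) ^+ m * (fun s => expR (- s^-1))); last first.
    by apply/funext => s; rewrite -[RHS]/(_ * _) exprfctE.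
  apply: is_derive_eq dM _.
  rewrite /flat t0 -![_ *: _]/(_ * _) opprK.
  rewrite -[(- _) t]/(- t^-1) exprfctE.
  clear dX; case: m => [|m] /=.
    by rewrite !expr0 !mul0r !mulr0 oppr0 mul0r add0r addr0 mul1r -exprVn mulrC.
  rewrite -exprVn !exprS; set e := expR _; set i := t^-1; set n := (m.+1)%:R.
  by rewrite expr0; ring.
- rewrite !flat_le0// mulr0 addr0.
  (* For [h > 0] the difference quotient at 0 is [flat m.+1 h], which [flat_le] squeezes between 0
     and a multiple of [h]; for [h <= 0] it vanishes. *)
  have c : (fun h => h^-1 *: (flat m (h%:A + 0) - flat m 0)) @ (0 : R)^' --> (0 : R).
    apply: (@squeeze_cvgr _ _ _ _ (cst 0) (fun h : R => m.+2`!%:R * `|h|)).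
    + near=> h; rewrite addr0 [h%:A]mulr1 (flat_le0 _ (lexx 0)) subr0.
      have [h0|h0] := ltP 0 h; last by rewrite flat_le0// scaler0 lexx mulr_ge0.
      have -> : h^-1 *: flat m h = flat m.+1 h.
        by rewrite /flat h0 exprS -mulrA.
      by rewrite /cst flat_ge0 (gtr0_norm h0) flat_le ?(ltW h0).
    + exact: cvg_cst.
    + rewrite -[X in _ --> X](mulr0 m.+2`!%:R).
      apply: cvgMl_tmp; rewrite -[X in _ --> X](@normr0 _ R).
      by apply: cvg_norm; exact: cvg_within.
  split; first by apply/cvg_ex; exists 0.
  exact: cvg_lim c.
Unshelve. all: by end_near. Qed.

End Flat.

(** * Algebraic closure properties of smooth functions *)

Section SmoothAlgebra.
Context {R : realType} {N : nat}.
Implicit Types f g : 'rV[R]_N -> R^o.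

(* A class of functions closed under partial derivatives and consisting of
   continuous, partially derivable functions consists of smooth functions; this
   one contains enough operations to build cutoffs. *)
Inductive smooth_alg : ('rV[R]_N -> R^o) -> Prop :=
| SmoothAlgSmooth f of smooth f : smooth_alg f
| SmoothAlgCoord i : smooth_alg (fun x => x 0 i)
| SmoothAlgCst c : smooth_alg (fun=> c)
| SmoothAlgAdd f g of smooth_alg f & smooth_alg g :
    smooth_alg (fun x => f x + g x)
| SmoothAlgMul f g of smooth_alg f & smooth_alg g :
    smooth_alg (fun x => f x * g x)
| SmoothAlgInv f of smooth_alg f & (forall x, f x != 0) :
    smooth_alg (fun x => (f x)^-1)
| SmoothAlgFlat m f of smooth_alg f : smooth_alg (fun x => flat m (f x)).

Lemma smooth_partial i f : smooth f -> smooth (partial i f).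
Proof. by move=> sf s; have := sf (rcons s i); rewrite /iter_partial foldr_rcons. Qed.

Lemma smooth_continuous f : smooth f -> continuous f.
Proof. by move=> /(_ [::])[]. Qed.

Lemma smooth_derivable f x i : smooth f -> derivable f x (delta_mx 0 i).
Proof. by move=> /(_ [::])[]. Qed.

Lemma is_derive_coord (x v : 'rV[R]_N) i :
  is_derive x v (fun y : 'rV[R]_N => y 0 i : R^o) (v 0 i).
Proof.
have did : derivable (@id 'rV[R]_N) x v by exact: derivable_id.
split; first by move: did => /derivable_mxP; exact.
have := derive_mx did; rewrite derive_id => /matrixP/(_ 0 i).
by rewrite mxE => ->.
Qed.

Lemma smooth_alg_continuous f : smooth_alg f -> continuous f.
Proof.
elim=> {f}.
- by move=> f sf; exact: smooth_continuous.
- by move=> i x; exact: coord_continuous.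
- by move=> c x; exact: cst_continuous.
- by move=> f g _ cf _ cg x; apply: (@continuousD _ _ _ f g x); [exact: cf|exact: cg].
- by move=> f g _ cf _ cg x; apply: (@continuousM _ _ f g x); [exact: cf|exact: cg].
- by move=> f _ cf f0 x; apply: (@continuousV _ _ f x); [exact: f0|exact: cf].
- move=> m f _ cf x; apply: (@continuous_comp _ _ _ f (flat m)); first exact: cf.
  apply/differentiable_continuous/derivable1_diffP.
  by have [] := is_derive_flat m (f x).
Qed.

Lemma smooth_alg_derive f i : smooth_alg f ->
  exists2 df, smooth_alg df & forall x, is_derive x (delta_mx 0 i) f (df x).
Proof.
elim=> {f}.
- move=> f sf; exists (partial i f); first exact/SmoothAlgSmooth/smooth_partial.
  by move=> x; apply: derivableP; exact: smooth_derivable.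
- move=> j; exists (fun=> (delta_mx 0 i : 'rV[R]_N) 0 j); first exact: SmoothAlgCst.
  by move=> x; exact: is_derive_coord.
- move=> c; exists (fun=> 0); first exact: SmoothAlgCst.
  by move=> x; exact: is_derive_cst.
- move=> f g _ [df sdf fd] _ [dg sdg gd].
  exists (fun x => df x + dg x); first exact: SmoothAlgAdd.
  by move=> x; exact: is_deriveD.
- move=> f g sf [df sdf fd] sg [dg sdg gd].
  exists (fun x => f x * dg x + g x * df x).
    by apply: SmoothAlgAdd; exact: SmoothAlgMul.
  by move=> x; exact: is_deriveM.
- move=> f sf [df sdf fd] f0.
  (* The derivative of 1/f is spelled with a factor -1 and a product of two inverses because
     [smooth_alg] has no constructor for opposites or powers. *)
  exists (fun x => -1 * ((f x)^-1 * (f x)^-1) * df x).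
    apply: SmoothAlgMul => //; apply: SmoothAlgMul; first exact: SmoothAlgCst.
    by apply: SmoothAlgMul; exact: SmoothAlgInv.
  move=> x; have [dfx <-] := fd x; split; first exact: derivableV.
  by rewrite deriveV// mulN1r -invfM -expr2.
- move=> m f sf [df sdf fd].
  exists (fun x => (- m%:R * flat m.+1 (f x) + flat m.+2 (f x)) * df x).
    apply: SmoothAlgMul => //; apply: SmoothAlgAdd; last exact: SmoothAlgFlat.
    by apply: SmoothAlgMul; [exact: SmoothAlgCst|exact: SmoothAlgFlat].
  by move=> x; apply: is_derive_comp1; exact: is_derive_flat.
Qed.

Lemma smooth_algE f : smooth_alg f -> smooth f.
Proof.
move=> sf s; have : smooth_alg (iter_partial s f).
  elim: s => //= i s /(smooth_alg_derive i)[df sdf dE].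
  rewrite (_ : partial i _ = df)//; apply/funext => x.
  by have [_] := dE x.
move: (iter_partial s f) => g sg; split; first exact: smooth_alg_continuous.
by move=> i x; have [dg _ /(_ x)[]] := smooth_alg_derive i sg.
Qed.

Lemma smoothM f g : smooth f -> smooth g -> smooth (fun x => f x * g x).
Proof.
by move=> sf sg; apply: smooth_algE; apply: SmoothAlgMul; exact: SmoothAlgSmooth.
Qed.

Lemma smooth_alg_sum (I : Type) (s : seq I) (F : I -> 'rV[R]_N -> R^o) :
  (forall i, smooth_alg (F i)) -> smooth_alg (fun x => \sum_(i <- s) F i x).
Proof.
move=> sF; elim: s => [|i s ih].
  by under eq_fun do rewrite big_nil; exact: SmoothAlgCst.
by under eq_fun do rewrite big_cons; exact: SmoothAlgAdd.
Qed.

Lemma smooth_alg_prod (I : Type) (s : seq I) (F : I -> 'rV[R]_N -> R^o) :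
  (forall i, smooth_alg (F i)) ->
  smooth_alg (fun x => \prod_(i <- s) (F i x : R)).
Proof.
move=> sF; elim: s => [|i s ih].
  by under eq_fun do rewrite big_nil; exact: SmoothAlgCst.
by under eq_fun do rewrite big_cons; exact: SmoothAlgMul.
Qed.

End SmoothAlgebra.

(** * A smooth Urysohn lemma in R^N *)

Section SmoothUrysohn.
Context {R : realType} {N : nat}.
Implicit Types (a x : 'rV[R]_N) (r : R) (K U : set 'rV[R]_N).

(** Positive exactly on the cube that is the open ball of the max norm, so covers by balls yield
    bumps directly. Squares stand in for absolute values to keep the factors smooth. *)
Definition cube_bump a r x : R^o :=
  \prod_(i < N) flat 0 (r ^+ 2 - (x 0 i - a 0 i) ^+ 2).

Lemma cube_bump_ge0 a r x : 0 <= cube_bump a r x.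
Proof. by apply: prodr_ge0 => i _; exact: flat_ge0. Qed.

Lemma cube_bump_gt0 a r x : 0 < r -> 0 < cube_bump a r x <-> ball a r x.
Proof.
move=> r0.
have E i : (0 < flat 0 (r ^+ 2 - (x 0 i - a 0 i) ^+ 2)) = (`|a 0 i - x 0 i| < r).
  rewrite flat_gt0 subr_gt0 -real_normK ?num_real// distrC.
  by rewrite ltr_pXn2r// nnegrE// ltW.
split=> [p0|[_ b]].
  split=> // i j; rewrite ord1; apply: contraT; rewrite -E -leNgt => le0.
  suff /eqP p : cube_bump a r x == 0 by rewrite p ltxx in p0.
  by apply/prodf_eq0; exists j => //; rewrite eq_le le0 flat_ge0.
by apply: prodr_gt0 => i _; rewrite E; exact: b.
Qed.

Lemma smooth_alg_cube_bump a r : smooth_alg (cube_bump a r).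
Proof.
apply: smooth_alg_prod => i; apply: SmoothAlgFlat.
rewrite (_ : (fun x => _) = fun x => r ^+ 2 +
    -1 * ((x 0 i + - a 0 i) * (x 0 i + - a 0 i))); last first.
  by apply/funext => x; rewrite mulN1r expr2.
have c : smooth_alg (fun x => x 0 i + - a 0 i).
  by apply: SmoothAlgAdd; [exact: SmoothAlgCoord|exact: SmoothAlgCst].
apply: SmoothAlgAdd; first exact: SmoothAlgCst.
by apply: SmoothAlgMul; [exact: SmoothAlgCst|exact: SmoothAlgMul].
Qed.

(** Finitely many cubes inside [U] cover [K], and the sum of their bumps has a minimum m > 0 on [K].
    A quotient of flat functions turns this sum into [phi], equal to 1 where the sum exceeds 2m/3
    and to 0 where it is at most m/3. The plateau [V] is open, so that derivatives on it are known
    as well. *)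
Lemma smooth_urysohn K U : compact K -> open U -> K `<=` U ->
  exists phi : 'rV[R]_N -> R^o,
  [/\ smooth phi, forall x, 0 <= phi x <= 1,
      exists V : set 'rV[R]_N, [/\ open V, K `<=` V & forall x, V x -> phi x = 1] &
      exists C : set 'rV[R]_N, [/\ compact C, C `<=` U & forall x, phi x != 0 -> C x]].
Proof.
(* The empty set is treated apart: the minimum of [Phi] over [K] needs a point. *)
move=> cK oU KU; have [->|K0] := eqVneq K set0.
  exists 0; split; first exact: smooth0.
  - by move=> x; rewrite lexx ler01.
  - by exists set0; split=> //; exact: open0.
  - by exists set0; split=> //; [exact: compact0|move=> x; rewrite eqxx].
pose D := [set p : 'rV[R]_N * R | 0 < p.2 /\ ball p.1 p.2 `<=` U].
have [D' D'D KD'] : finite_subset_cover D (fun p => ball p.1 p.2) K.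
  move: cK; rewrite compact_cover; apply; first by move=> p [p0 _]; exact: ball_open.
  move=> x Kx; have /nbhs_ballP[r /= r0 rU] : nbhs x U.
    by apply: open_nbhs_nbhs; split=> //; exact: KU.
  by exists (x, r) => //; exact: ballxx.
pose Phi x : R^o := \sum_(p <- D') cube_bump p.1 p.2 x.
have sPhi : smooth_alg Phi by apply: smooth_alg_sum => p; exact: smooth_alg_cube_bump.
have cPhi : continuous Phi by exact: smooth_alg_continuous.
have Phi_ge0 x : 0 <= Phi x by apply: sumr_ge0 => p _; exact: cube_bump_ge0.
have Phi_gt0 x : 0 < Phi x -> exists2 p, p \in D' & ball p.1 p.2 x.
  move=> P0; have : Phi x != 0 by rewrite gt_eqF.
  rewrite /Phi psumr_neq0; last by move=> p _; exact: cube_bump_ge0.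
  move=> /hasP[p pD' /= b]; exists p => //.
  by apply/cube_bump_gt0 => //; have /set_mem[] := D'D _ pD'.
have K_gt0 x : K x -> 0 < Phi x.
  move=> /KD'[p /= pD' b]; rewrite /Phi (big_rem p)//=.
  apply: ltr_pwDl; last by apply: sumr_ge0 => q _; exact: cube_bump_ge0.
  by apply/cube_bump_gt0 => //; have /set_mem[] := D'D _ pD'.
have [y yK ymin] : exists2 y, y \in K & forall t, t \in K -> Phi y <= Phi t.
  apply: (compact_EVT_min _ cK); first exact/set0P.
  exact/continuous_subspaceT.
pose m := Phi y; have m0 : 0 < m by apply: K_gt0; exact/set_mem.
(* The two never vanish together: [u] is positive where [Phi] exceeds m/3, and [w] where [Phi] is
   below 2m/3. *)
pose u x : R := flat 0 (Phi x - m / 3); pose w x : R := flat 0 (2 * m / 3 - Phi x).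
have uw_gt0 x : 0 < u x + w x.
  have [h|h] := ltP (m / 3) (Phi x).
    by apply: ltr_pwDl; [rewrite flat_gt0 subr_gt0|exact: flat_ge0].
  apply: ltr_wpDl; [exact: flat_ge0|rewrite flat_gt0 subr_gt0].
  by apply: le_lt_trans h _; lra.
exists (fun x => u x / (u x + w x)); split.
- apply: smooth_algE.
  have su : smooth_alg u.
    by apply: SmoothAlgFlat; apply: SmoothAlgAdd => //; exact: SmoothAlgCst.
  have sw : smooth_alg w.
    apply: SmoothAlgFlat; apply: SmoothAlgAdd; first exact: SmoothAlgCst.
    rewrite (_ : (fun x => - Phi x) = fun x => -1 * Phi x).
      by apply: SmoothAlgMul => //; exact: SmoothAlgCst.
    by apply/funext => x; rewrite mulN1r.
  apply: SmoothAlgMul => //; apply: SmoothAlgInv; first exact: SmoothAlgAdd.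
  by move=> x; rewrite gt_eqF.
- move=> x; rewrite divr_ge0 ?flat_ge0 ?(ltW (uw_gt0 x))//=.
  by rewrite ler_pdivrMr// mul1r lerDl flat_ge0.
- exists [set x | 2 * m / 3 < Phi x]; split.
  + exact: (open_comp (fun x _ => cPhi x) (@open_gt _ (2 * m / 3))).
  + move=> x Kx; apply: (@lt_le_trans _ _ m); last by apply: ymin; exact/mem_set.
    by rewrite -/m; lra.
  + move=> x /= h; rewrite /w flat_le0 ?addr0; last by rewrite subr_le0 ltW.
    rewrite divff// gt_eqF// flat_gt0 subr_gt0; apply: lt_trans h.
    by lra.
- exists [set x | m / 3 <= Phi x].
  have m3 : 0 < m / 3 by rewrite divr_gt0.
  split.
  + apply: bounded_closed_compact; last first.
      exact: (closed_comp (fun x _ => cPhi x) (@closed_ge _ (m / 3))).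
    (* Each point with [Phi x >= m / 3] lies in one of the finitely many balls, so its norm is at
       most the norm of a centre plus a radius; the sum bounds all of these. *)
    exists (\sum_(p <- D') (`|p.1| + `|p.2|)); split; first exact: num_real.
    move=> M hM x /= /(lt_le_trans m3)/Phi_gt0[p pD' b].
    apply: le_trans (ltW hM); rewrite (big_rem p)//=.
    apply: (@le_trans _ _ (`|p.1| + `|p.2|)).
      move: b; rewrite -ball_normE /= => b.
      rewrite -[x in `|x|](subrK p.1) addrC (le_trans (ler_normD _ _))// lerD2l.
      by rewrite distrC (le_trans (ltW b))// ler_norm.
    by rewrite lerDl sumr_ge0// => q _; rewrite addr_ge0.
  + move=> x /= /(lt_le_trans m3)/Phi_gt0[p pD' b].
    by have /set_mem[_] := D'D _ pD'; exact.
  + move=> x /=; rewrite leNgt; apply: contra_neqN => h.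
    by rewrite /u flat_le0 ?mul0r// subr_le0 ltW.
Qed.

End SmoothUrysohn.

(** * The mass measure of a current *)

Section TestForms.
Context {R : realType} {N n : nat}.
Implicit Types (v w : test_form R N n) (c : R).

Lemma pairingZr (xi : nvector R N n) c (w : ncovector R N n) :
  pairing xi (c *: w) = c * pairing xi w.
Proof.
rewrite /pairing mulr_sumr; apply: eq_bigr => I _.
by rewrite ffunE -[_ *: _]/(c * w I) mulrCA.
Qed.

Lemma comassZ_le1 c (w : ncovector R N n) :
  0 <= c <= 1 -> (comass w <= 1)%E -> (comass (c *: w) <= 1)%E.
Proof.
move=> /andP[c0 c1] w1; apply/ge_ereal_sup => _ [xi xi1 <-].
rewrite pairingZr lee_fin.
have : pairing xi w <= 1.
  by rewrite -lee_fin; apply: le_trans w1; apply: ereal_sup_ubound; exists xi.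
by move=> /(ler_wpM2l c0)/le_trans; apply; rewrite mulr1.
Qed.

Lemma comass0_le1 : (comass (0%R : ncovector R N n) <= 1)%E.
Proof.
apply/ge_ereal_sup => _ [xi xi1 <-]; rewrite lee_fin /pairing big1// => I _.
by rewrite ffunE mulr0.
Qed.

Lemma form_smooth w I : smooth (form_coef w I).
Proof. by have /asboolP[sw _] := valP w. Qed.

Lemma form_compact w : compact (form_support w).
Proof. by have /asboolP[] := valP w. Qed.

Lemma form_support_val w x : w x != 0 -> form_support w x.
Proof. by move=> wx; apply: subset_closure. Qed.

Lemma form_mul (phi : 'rV[R]_N -> R^o) w : smooth phi ->
  exists v, forall x, v x = phi x *: w x.
Proof.
move=> sphi; suff P : (fun x => phi x *: w x) \in @is_test_form R N n.
  by exists (TestForm P).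
apply/asboolP; split=> [I|].
  rewrite (_ : form_coef _ _ = fun x => phi x * form_coef w I x).
    exact/smoothM/form_smooth.
  by apply/funext => x; rewrite /form_coef ffunE.
apply: (@subclosed_compact _ _ (form_support w)); first exact: closed_closure.
  exact: form_compact.
by apply: closureS => x /=; apply: contra_neq => ->; rewrite scaler0.
Qed.

Lemma form_support_sub w (C : set 'rV[R]_N) : closed C ->
  (forall x, w x != 0 -> C x) -> form_support w `<=` C.
Proof. by move=> /closure_id cC wC; rewrite cC; exact: closureS. Qed.

End TestForms.

(** * From the mass of open sets to an outer measure and a Borel measure *)

Section MassOpen.
Context {R : realType} {N n : nat}.
Variable S : current R N n.
Implicit Types (A B O : set 'rV[R]_N) (v w : test_form R N n).

Lemma mass_open_ge w O : (forall x, (comass (w x) <= 1)%E) ->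
  form_support w `<=` O -> ((S w)%:E <= mass_open S O)%E.
Proof. by move=> w1 wO; apply: ereal_sup_ubound; exists w. Qed.

Lemma mass_open_ge0 O : (0 <= mass_open S O)%E.
Proof.
apply: ereal_sup_ubound; exists 0; last by rewrite raddf0.
split; first by move=> x; exact: comass0_le1.
rewrite /form_support (_ : [set _ | _] = set0) ?closure0//.
by rewrite -subset0 => x /=; rewrite eqxx.
Qed.

Lemma le_mass_open A B : A `<=` B -> (mass_open S A <= mass_open S B)%E.
Proof.
move=> AB; apply/ge_ereal_sup => _ [w [w1 wA] <-].
by apply: mass_open_ge => //; exact: subset_trans AB.
Qed.

Lemma mass_open0 : mass_open S set0 = 0%E.
Proof.
apply/eqP; rewrite eq_le mass_open_ge0 andbT.
apply/ge_ereal_sup => _ [w [_ w0] <-].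
suff -> : w = 0 by rewrite raddf0.
apply/val_inj/funext => x; apply: contrapT => /eqP wx.
by have := w0 x (form_support_val wx).
Qed.

(** With a cutoff [phi] that is 1 near the part of the support outside [B] and is supported in [A],
    the forms [phi *: w] and [(1 - phi) *: w] are admissible for [A] and [B]. *)
Lemma mass_openU A B : open A -> open B ->
  (mass_open S (A `|` B) <= mass_open S A + mass_open S B)%E.
Proof.
move=> oA oB; apply/ge_ereal_sup => _ [w [w1 wAB] <-].
have cK : compact (form_support w `&` ~` B).
  apply: (@subclosed_compact _ _ (form_support w)); last by move=> x [].
    by apply: closedI; [exact: closed_closure|exact: open_closedC].
  exact: form_compact.
have KA : form_support w `&` ~` B `<=` A by move=> x [/wAB[]].
have [phi [sphi phi01 [V [oV KV V1]] [C [cC CA phiC]]]] := smooth_urysohn cK oA KA.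
have [v1 v1E] := form_mul w sphi.
have [v2 v2E] := form_mul w (smooth_lin (-1) sphi (smooth_algE (SmoothAlgCst 1))).
have phi'E x : (-1 *: phi + (fun=> 1)) x = 1 - phi x.
  by rewrite -[LHS]/(-1 * phi x + 1) mulN1r addrC.
have -> : w = v1 + v2.
  apply/val_inj/funext => x /=; rewrite -[RHS]/(v1 x + v2 x).
  by rewrite v1E v2E phi'E scalerBl scale1r addrC subrK.
rewrite raddfD EFinD; apply: leeD; apply: mass_open_ge.
- by move=> x; rewrite v1E; exact: comassZ_le1.
- apply: subset_trans CA; apply: form_support_sub.
    exact: compact_closed.
  move=> x v1x; apply: phiC; apply: contra_neq v1x => phi0.
  by rewrite v1E phi0 scale0r.
- move=> x; rewrite v2E phi'E; apply: comassZ_le1 => //.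
  by have /andP[p0 p1] := phi01 x; rewrite subr_ge0 p1 lerBlDr lerDl.
(* The factor 1 - phi vanishes on the whole open set [V], so even the closure of the points where
   [v2] is nonzero avoids [V], hence avoids the part of the support outside [B]. *)
- apply: (@subset_trans _ (form_support w `&` ~` V)).
    apply: form_support_sub.
      by apply: closedI; [exact: closed_closure|exact: open_closedC].
    move=> x v2x; split.
      apply: form_support_val; apply: contra_neq v2x => w0.
      by rewrite v2E w0 scaler0.
    by move=> Vx; move: v2x; rewrite v2E phi'E V1// subrr scale0r eqxx.
  by move=> x [wx nVx]; apply: contrapT => nBx; exact/nVx/KV.
Qed.

(** Test forms have compact support, so finitely many [F i] already contain it and the case of two
    sets applies by induction. *)
Lemma mass_open_bigcup (F : (set 'rV[R]_N)^nat) : (forall i, open (F i)) ->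
  (mass_open S (\bigcup_i F i) <= \sum_(i <oo) mass_open S (F i))%E.
Proof.
move=> oF; apply/ge_ereal_sup => _ [w [w1 wF] <-].
have [D' _ D'w] : finite_subset_cover setT F (form_support w).
  have := @form_compact _ _ _ w; rewrite compact_cover; apply => //.
pose m := (\max_(i <- D') i).+1.
apply: (@le_trans _ _ (mass_open S (\big[setU/set0]_(i < m) F i))).
  apply: mass_open_ge => // x /D'w[i /= iD' Fix].
  rewrite -bigcup_mkord; exists i => //=.
  by rewrite ltnS; apply: leq_bigmax_seq.
apply: (@le_trans _ _ (\sum_(i < m) mass_open S (F i))%E); last first.
  rewrite -(big_mkord xpredT (fun i => mass_open S (F i))).
  by apply: nneseries_lim_ge => i _ _; exact: mass_open_ge0.
elim: m => [|m ih]; first by rewrite !big_ord0 mass_open0.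
rewrite !big_ord_recr /=; apply: le_trans (leeD2r _ ih).
apply: mass_openU => //; rewrite -bigcup_mkord; exact: bigcup_open.
Qed.

Lemma mass_openE O : open O -> mass S O = mass_open S O.
Proof.
move=> oO; apply/eqP; rewrite eq_le; apply/andP; split.
  by apply: ereal_inf_lbound; exists O => //; split.
by apply/le_ereal_inf_tmp => _ [U [oU OU] <-]; exact: le_mass_open.
Qed.

Lemma mass_ge0 A : (0 <= mass S A)%E.
Proof. by apply/le_ereal_inf_tmp => _ [U _ <-]; exact: mass_open_ge0. Qed.

Lemma mass0 : mass S set0 = 0%E.
Proof. by rewrite mass_openE ?mass_open0//; exact: open0. Qed.

Lemma le_mass : {homo mass S : A B / A `<=` B >-> (A <= B)%E}.
Proof.
move=> A B AB; apply/le_ereal_inf_tmp => _ [U [oU BU] <-].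
by apply: ereal_inf_lbound; exists U => //; split=> //; exact: subset_trans BU.
Qed.

Lemma mass_sigma_subadditive : sigma_subadditive (mass S).
Proof.
move=> A; have [[i ioo]|] := pselect (exists i, mass S (A i) = +oo%E).
  rewrite (eseries_pinfty _ _ ioo) ?leey// => k _.
  by rewrite -ltNye (lt_le_trans _ (mass_ge0 _)).
rewrite -forallNE => Aoo; apply/lee_addgt0Pr => e e0.
rewrite (le_trans _ (epsilon_trick _ _ (ltW e0)))//; last by move=> k; exact: mass_ge0.
have fA i : mass S (A i) \is a fin_num by rewrite ge0_fin_numE ?mass_ge0// ltey; exact/eqP.
have /choice[U UP] i : exists U, [/\ open U, A i `<=` U &
    (mass_open S U <= mass S (A i) + (e / (2 ^ i.+1)%:R)%:E)%E].
  have ei : 0 < e / (2 ^ i.+1)%:R by rewrite divr_gt0// ltr0n expn_gt0.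
  have [_ [U [oU AU] <-] /ltW h] := lb_ereal_inf_adherent ei (fA i).
  by exists U.
apply: (@le_trans _ _ (\sum_(i <oo) mass_open S (U i))%E); last first.
  by apply: lee_nneseries => i _ *; [exact: mass_open_ge0|have [] := UP i].
apply: le_trans (mass_open_bigcup _); last by move=> i; have [] := UP i.
apply: ereal_inf_lbound; exists (\bigcup_i U i) => //; split.
  by apply: bigcup_open => i _; have [] := UP i.
by apply: subset_bigcup => i _; have [] := UP i.
Qed.

HB.instance Definition _ := isOuterMeasure.Build R _ (mass S) mass0 mass_ge0
  le_mass mass_sigma_subadditive.

(* Two nearly optimal forms, one with compact support K inside B `&` O and one
   supported in B `\` K, have a sum of comass at most 1. *)
Lemma mass_open_split O B : open O -> open B ->
  (mass S (B `&` O) + mass S (B `&` ~` O) <= mass_open S B)%E.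
Proof.
move=> oO oB; have [Boo|Bfin] := eqVneq (mass_open S B) +oo%E; first by rewrite Boo leey.
have BOfin : mass_open S (B `&` O) \is a fin_num.
  rewrite ge0_fin_numE ?mass_open_ge0//.
  by apply: (@le_lt_trans _ _ (mass_open S B)); [exact: le_mass_open|rewrite ltey].
rewrite mass_openE; last exact: openI.
apply/lee_addgt0Pr => e e0; have e20 : 0 < e / 2 by rewrite divr_gt0.
have [_ [w [w1 wBO] <-] we] := ub_ereal_sup_adherent e20 BOfin.
set K := form_support w.
have oBK : open (B `&` ~` K).
  by apply: openI => //; apply: closed_openC; exact: closed_closure.
have BKfin : mass_open S (B `&` ~` K) \is a fin_num.
  rewrite ge0_fin_numE ?mass_open_ge0//.
  by apply: (@le_lt_trans _ _ (mass_open S B)); [exact: le_mass_open|rewrite ltey].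
have [_ [v [v1 vBK] <-] ve] := ub_ereal_sup_adherent e20 BKfin.
apply: (@le_trans _ _ ((S w)%:E + (e / 2)%:E + ((S v)%:E + (e / 2)%:E))%E).
  apply: leeD; first by rewrite -leeBlDr// ltW.
  (* Since [K] lies in [O], removing [O] from [B] leaves a subset of the open set [B] minus [K]. *)
  apply: (@le_trans _ _ (mass_open S (B `&` ~` K))).
    rewrite -mass_openE//; apply: le_mass => x [Bx nOx]; split=> // /wBO[_].
    exact: nOx.
  by rewrite -leeBlDr// ltW.
rewrite addeACA -!EFinD -splitr EFinD leeD2r// -raddfD.
apply: mass_open_ge.
  move=> x; rewrite -[(w + v : test_form _ _ _) x]/(w x + v x).
  have [->|wx] := eqVneq (w x) 0; first by rewrite add0r.
  suff -> : v x = 0 by rewrite addr0.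
  apply: contrapT => /eqP vx; have [_] := vBK _ (form_support_val vx).
  by apply; exact: form_support_val.
apply: (@subset_trans _ (form_support w `|` form_support v)).
  apply: form_support_sub; first by apply: closedU; exact: closed_closure.
  move=> x; rewrite -[(w + v : test_form _ _ _) x]/(w x + v x).
  have [->|wx _] := eqVneq (w x) 0; last by left; exact: form_support_val.
  by rewrite add0r => vx; right; exact: form_support_val.
by move=> x [/wBO[]|/vBK[]].
Qed.

(** As [mass] is an infimum over open supersets, the criterion need only be checked against open
    sets, which is [mass_open_split]. *)
Lemma open_caratheodory O : open O -> (mass S).-caratheodory O.
Proof.
move=> oO; apply: le_caratheodory_measurable => A.
apply/le_ereal_inf_tmp => _ [B [oB AB] <-].
apply: le_trans (mass_open_split oO oB).
by apply: leeD; apply: le_mass; exact: setSI.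
Qed.

Local Notation borelRN := (g_sigma_algebraType (@open 'rV[R]_N)).

Lemma borel_caratheodory (A : set borelRN) :
  measurable A -> (mass S).-caratheodory A.
Proof.
move: A; apply: smallest_sub; last exact: open_caratheodory.
split; first exact: caratheodory_measurable_set0.
- by move=> A mA; rewrite setTD; exact: caratheodory_measurable_setC.
- by move=> F mF; exact: caratheodory_measurable_bigcup.
Qed.

Lemma mass_sigma_additive : semi_sigma_additive (mass S : set borelRN -> \bar R).
Proof.
move=> F mF tF mUF.
apply: (@caratheodory_measure_sigma_additive R _ (mass S)) => //.
- by move=> i; exact: borel_caratheodory.
- exact: borel_caratheodory.
Qed.

(** A second name for [mass S]: that one carries the outer measure structure, this one the measure
    structure on Borel sets. *)
Definition mass_measure (A : set borelRN) : \bar R := mass S A.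

HB.instance Definition _ := isMeasure.Build _ borelRN R mass_measure mass0 mass_ge0
  mass_sigma_additive.

End MassOpen.

(** * Weak convergence *)

Section BorelFunctions.
Context {R : realType} {T : ptopologicalType}.
Local Notation borel := (g_sigma_algebraType (@open T)).

Lemma borel_open (A : set T) : open A -> measurable (A : set borel).
Proof. by move=> oA; exact: sub_sigma_algebra. Qed.

Lemma borel_continuous (g : T -> R) :
  continuous g -> measurable_fun [set: borel] (g : borel -> R).
Proof.
move=> /continuousP cg; apply: (measurability _ (RGenOpens.measurableE R)).
move=> _ [_ [a [b ->] <-]]; rewrite setTI; apply: borel_open.
exact/cg/interval_open.
Qed.

Definition bounded_continuous (g : T -> R) :=
  continuous g /\ exists M, forall x, `|g x| <= M.

Lemma bounded_continuous_integrable (mu : {measure set borel -> \bar R}) g :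
  (mu setT < +oo)%E -> bounded_continuous g -> mu.-integrable setT (EFin \o g).
Proof.
move=> muT [cg [M gM]]; apply: measurable_bounded_integrable => //.
  exact: borel_continuous.
by exists M; split; [exact: num_real|move=> r Mr x _; exact: le_trans (gM x) (ltW Mr)].
Qed.

Lemma bounded_continuous_cst c : bounded_continuous (fun=> c).
Proof. by split; [move=> x; exact: cst_continuous|exists `|c|]. Qed.

Lemma bounded_continuousD g h : bounded_continuous g -> bounded_continuous h ->
  bounded_continuous (fun x => g x + h x).
Proof.
move=> [cg [M gM]] [ch [K hK]]; split.
  by move=> x; apply: (@continuousD _ _ _ g h x); [exact: cg|exact: ch].
by exists (M + K) => x; rewrite (le_trans (ler_normD _ _))// lerD.
Qed.

Lemma bounded_continuousM g h : bounded_continuous g -> bounded_continuous h ->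
  bounded_continuous (fun x => g x * h x).
Proof.
move=> [cg [M gM]] [ch [K hK]]; split.
  by move=> x; apply: (@continuousM _ _ g h x); [exact: cg|exact: ch].
by exists (M * K) => x; rewrite normrM ler_pM.
Qed.

Lemma bounded_continuous_sum (I : Type) (s : seq I) (F : I -> T -> R) :
  (forall i, bounded_continuous (F i)) ->
  bounded_continuous (fun x => \sum_(i <- s) F i x).
Proof.
move=> bF; elim: s => [|i s ih].
  by under eq_fun do rewrite big_nil; exact: bounded_continuous_cst.
by under eq_fun do rewrite big_cons; exact: bounded_continuousD.
Qed.

Lemma Rintegral_sum (mu : {measure set borel -> \bar R}) (I : Type) (s : seq I)
    (F : I -> T -> R) : (mu setT < +oo)%E -> (forall i, bounded_continuous (F i)) ->
  \int[mu]_x (\sum_(i <- s) F i x) = \sum_(i <- s) \int[mu]_x F i x.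
Proof.
move=> muT bF; elim: s => [|i s ih].
  under eq_Rintegral do rewrite big_nil.
  by rewrite big_nil Rintegral_cst// mul0r.
under eq_Rintegral do rewrite big_cons.
rewrite big_cons -ih RintegralD//; apply: bounded_continuous_integrable => //.
exact: bounded_continuous_sum.
Qed.

End BorelFunctions.

(** * Discrete layer-cake approximation *)

Section Staircase.
Context {R : realType}.

(** The number of integers j with 1 <= j <= m and j < t. At t = m g(x) it is a sum of indicators of
    superlevel sets of g. *)
Definition staircase (m : nat) (t : R) : R := \sum_(j < m) (j.+1%:R < t)%R%:R.

Lemma staircase_bounds m t : 0 <= t <= m%:R ->
  staircase m t <= t <= staircase m t + 1.
Proof.
(* The induction also carries the exact value for [t] beyond [m], which is used when [t] lies in the
   last unit interval. *)
move=> /andP[t0]; suff [_] : (m%:R < t -> staircase m t = m%:R) /\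
  (t <= m%:R -> staircase m t <= t <= staircase m t + 1) by exact.
elim: m => [|m [ih1 ih2]]; rewrite /staircase ?big_ord0 ?big_ord_recr /=.
  by split=> // t_le0; rewrite add0r t0 (le_trans t_le0).
rewrite -/(staircase m t); split=> [mt|tm].
  by rewrite mt ih1 ?natr1// (lt_trans _ mt)// ltr_nat.
rewrite ltNge tm addr0; have [/ih2//|mt] := leP t m%:R.
by rewrite ih1// natr1 tm ltW.
Qed.

End Staircase.

(** * Convergence of integrals from lower semicontinuity on open sets and convergence of total
    masses *)

Section WeakConvergence.
Context {R : realType} {T : ptopologicalType}.
Local Notation borel := (g_sigma_algebraType (@open T)).

(** Integrating [staircase_bounds] at [m%:R * g x] shows that the measures of the open superlevel
    sets determine the integral of [g] up to the total mass divided by [m]. *)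
Lemma staircase_integral (mu : {measure set borel -> \bar R}) (g : T -> R) m :
  (mu setT < +oo)%E -> continuous g -> (forall x, 0 <= g x <= 1) ->
  \sum_(j < m) fine (mu [set x | j.+1%:R < m%:R * g x]) <= m%:R * \int[mu]_x g x <=
  \sum_(j < m) fine (mu [set x | j.+1%:R < m%:R * g x]) + fine (mu setT).
Proof.
move=> muT cg g01.
have bg : bounded_continuous g.
  by split=> //; exists 1 => x; have /andP[? ?] := g01 x; rewrite ger0_norm.
have ig := bounded_continuous_integrable muT bg.
pose A (j : nat) : set borel := [set x | j.+1%:R < m%:R * g x].
have cmg : continuous (fun x => m%:R * g x).
  by move=> x; apply: (@continuousM _ _ (cst m%:R) g x); [exact: cst_continuous|exact: cg].
have mA j : measurable (A j).
  by apply: borel_open; exact: (open_comp (fun x _ => cmg x) (@open_gt _ j.+1%:R)).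
have muA j : mu (A j) \is a fin_num.
  rewrite ge0_fin_numE// (le_lt_trans _ muT)//.
  by apply: le_measure => //; apply/mem_set; [exact: mA|exact: measurableT].
have mmg : measurable_fun [set: borel] (fun x : borel => (m%:R * g x)%:E).
  by apply/measurable_EFinP; exact: borel_continuous cmg.
have mg0 x : (0 <= (m%:R * g x)%:E)%E by rewrite lee_fin mulr_ge0//; case/andP: (g01 x).
have E : (m%:R * \int[mu]_x g x)%:E = (\int[mu]_x (m%:R * g x)%:E)%E.
  rewrite -RintegralZl// /Rintegral fineK//; apply: integrable_fin_num => //.
  apply: bounded_continuous_integrable => //.
  by apply: bounded_continuousM => //; exact: bounded_continuous_cst.
have mI j : measurable_fun [set: borel] (fun x => (\1_(A j) x)%:E : \bar R).
  exact/measurable_EFinP/measurable_indic.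
have SE : (\sum_(j < m) fine (mu (A j)))%:E =
    (\int[mu]_x \sum_(j < m) (\1_(A j) x)%:E)%E.
  rewrite ge0_integral_sum//.
  rewrite -sumEFin; apply: eq_bigr => j _.
  by rewrite integral_indic// setIT fineK.
have stE x : (\sum_(j < m) (\1_(A j) x)%:E)%E = (staircase m (m%:R * g x))%:E :> \bar R.
  rewrite sumEFin /staircase; congr EFin; apply: eq_bigr => j _.
  by rewrite indicE; congr (nat_of_bool _)%:R; apply/idP/idP => [/set_mem|/mem_set].
have st x : staircase m (m%:R * g x) <= m%:R * g x <= staircase m (m%:R * g x) + 1.
  apply: staircase_bounds; have /andP[g0 g1] := g01 x.
  by rewrite mulr_ge0//= ler_piMr.
have mS : measurable_fun [set: borel] (fun x => \sum_(j < m) (\1_(A j) x)%:E : \bar R)%E.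
  exact: emeasurable_sum.
have S0 x : (0 <= \sum_(j < m) (\1_(A j) x)%:E :> \bar R)%E by apply: sume_ge0.
apply/andP; split; rewrite -lee_fin ?EFinD SE E.
  apply: ge0_le_integral => // x _.
  by rewrite stE lee_fin; case/andP: (st x).
rewrite fineK ?ge0_fin_numE//.
rewrite -[mu setT]mul1e -integral_cst// -ge0_integralD//.
apply: ge0_le_integral => //.
- exact: emeasurable_funD.
- by move=> x _; rewrite stE -EFinD lee_fin; case/andP: (st x).
Qed.

Variables (mu_ : nat -> {measure set borel -> \bar R}) (mu : {measure set borel -> \bar R}).
Hypotheses (mu_T : forall i, (mu_ i setT < +oo)%E) (muT : (mu setT < +oo)%E).
Hypothesis lsc : forall O : set T, open O -> forall r : R, (r%:E < mu O)%E ->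
  \forall i \near \oo, (r%:E < mu_ i O)%E.
Hypothesis total_cvg : fine (mu_ i setT) @[i --> \oo] --> fine (mu setT).

Lemma Rintegral_lower_semicontinuous (g : T -> R) (e : R) : continuous g ->
  (forall x, 0 <= g x <= 1) -> 0 < e ->
  \forall i \near \oo, \int[mu]_x g x - e < \int[mu_ i]_x g x.
Proof.
move=> cg g01 e0.
(* Chosen so that total mass / m < e / 2. Each of the [m] superlevel sets may then lose e / 2 in
   measure, and after division by [m] the two errors stay below [e]. *)
pose m := (Num.truncn (fine (mu setT) / (e / 2))).+1.
have m0 : 0 < m%:R :> R by rewrite ltr0n.
have hm : fine (mu setT) < m%:R * (e / 2).
  by rewrite -ltr_pdivrMr ?divr_gt0// truncnS_gt.
pose A (j : nat) : set T := [set x | j.+1%:R < m%:R * g x].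
have oA j : open (A j).
  have cmg : continuous (fun x => m%:R * g x).
    by move=> x; apply: (@continuousM _ _ (cst m%:R) g x); [exact: cst_continuous|exact: cg].
  exact: (open_comp (fun x _ => cmg x) (@open_gt _ j.+1%:R)).
have finA (nu : {measure set borel -> \bar R}) j :
    (nu setT < +oo)%E -> nu (A j) \is a fin_num.
  move=> nuT; rewrite ge0_fin_numE// (le_lt_trans _ nuT)//.
  by apply: le_measure => //; apply/mem_set; [exact: borel_open|exact: measurableT].
have /andP[_ upper] := staircase_integral m muT cg g01.
near=> i.
have /andP[lower _] := staircase_integral m (mu_T i) cg g01.
have hA (j : 'I_m) : fine (mu (A j)) - e / 2 <= fine (mu_ i (A j)).
  rewrite ltW// -lte_fin (fineK (finA _ _ (mu_T i))).
  move: j; near: i; apply: filter_forall => j.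
  apply: lsc => //; rewrite EFinB fineK ?finA// lteBlDr// lteDl ?finA//.
  by rewrite lte_fin divr_gt0.
have : \sum_(j < m) fine (mu (A j)) - m%:R * (e / 2) <= \sum_(j < m) fine (mu_ i (A j)).
  rewrite (_ : m%:R * (e / 2) = \sum_(j < m) (e / 2)); last first.
    by rewrite sumr_const card_ord mulr_natl.
  by rewrite -sumrB; apply: ler_sum => j _; exact: hA.
move: lower upper hm; rewrite -/m.
set s1 := \sum_(j < m) _; set s2 := \sum_(j < m) _.
move=> lower upper hm hs; rewrite -(ltr_pM2l m0) mulrBr.
have : m%:R * e = m%:R * (e / 2) + m%:R * (e / 2).
  by rewrite -mulrDr -splitr.
by lra.
Unshelve. all: by end_near. Qed.

(** Lower semicontinuity for [g] gives one inequality. Applied to 1 - g, which also takes values in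
    [0,1], it gives the other, because the total masses converge. *)
Lemma Rintegral_cvg01 (g : T -> R) : continuous g -> (forall x, 0 <= g x <= 1) ->
  \int[mu_ i]_x g x @[i --> \oo] --> \int[mu]_x g x.
Proof.
move=> cg g01; apply/cvgrPdist_lt => e e0.
have e20 : 0 < e / 2 by rewrite divr_gt0.
have bg : bounded_continuous g.
  by split=> //; exists 1 => x; have /andP[? ?] := g01 x; rewrite ger0_norm.
have c1g : continuous (fun x => 1 - g x).
  by move=> x; apply: cvgB; [exact: cvg_cst|exact: cg].
have g'01 x : 0 <= 1 - g x <= 1.
  by have /andP[g0 g1] := g01 x; rewrite subr_ge0 g1 lerBlDr lerDl.
have IB (nu : {measure set borel -> \bar R}) : (nu setT < +oo)%E ->
    \int[nu]_x (1 - g x) = fine (nu setT) - \int[nu]_x g x.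
  move=> nuT; rewrite RintegralB//.
  - by rewrite Rintegral_cst// mul1r.
  - by apply: bounded_continuous_integrable => //; exact: bounded_continuous_cst.
  - exact: bounded_continuous_integrable.
near=> i.
have h1 : \int[mu]_x g x - e < \int[mu_ i]_x g x.
  by near: i; exact: Rintegral_lower_semicontinuous.
have h2 : \int[mu]_x (1 - g x) - e / 2 < \int[mu_ i]_x (1 - g x).
  by near: i; exact: Rintegral_lower_semicontinuous.
have h3 : `|fine (mu setT) - fine (mu_ i setT)| < e / 2.
  by near: i; move/cvgrPdist_lt: total_cvg; apply.
move: h2 h3; rewrite !IB// !ltr_norml => h2 /andP[h3 h4].
by apply/andP; split; lra.
Unshelve. all: by end_near. Qed.

Lemma Rintegral_cvg (g : T -> R) : bounded_continuous g ->
  \int[mu_ i]_x g x @[i --> \oo] --> \int[mu]_x g x.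
Proof.
move=> bg; have [cg [M gM]] := bg.
have M0 : 0 <= M by apply: le_trans (gM point); exact: normr_ge0.
(* An affine change of [g] maps it into [0,1]; [K] exceeds [M] so that the divisor is positive even
   when [M] is 0. *)
pose K := M + 1; have K0 : 0 < K by rewrite ltr_wpDl.
pose h x := (2 * K)^-1 * (g x + K).
have bh : bounded_continuous h.
  apply: bounded_continuousM; first exact: bounded_continuous_cst.
  by apply: bounded_continuousD => //; exact: bounded_continuous_cst.
have h01 x : 0 <= h x <= 1.
  have := gM x; rewrite ler_norml => /andP[g1 g2].
  have K20 : 0 < 2 * K by rewrite mulr_gt0.
  rewrite /h mulr_ge0 ?invr_ge0 ?(ltW K20)//=; last by rewrite /K; lra.
  by rewrite mulrC ler_pdivrMr// mul1r /K; lra.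
have gE x : g x = 2 * K * h x + - K.
  by rewrite /h mulVKf ?addrK// mulf_neq0// gt_eqF.
have IE (nu : {measure set borel -> \bar R}) : (nu setT < +oo)%E ->
    \int[nu]_x g x = 2 * K * \int[nu]_x h x + - K * fine (nu setT).
  move=> nuT; under eq_Rintegral do rewrite gE.
  rewrite RintegralD//.
  - by rewrite RintegralZl ?Rintegral_cst//; exact: bounded_continuous_integrable.
  - apply: bounded_continuous_integrable => //; apply: bounded_continuousM => //.
    exact: bounded_continuous_cst.
  - by apply: bounded_continuous_integrable => //; exact: bounded_continuous_cst.
under eq_fun do rewrite IE//.
rewrite IE//; apply: cvgD; apply: cvgMl_tmp => //.
by apply: Rintegral_cvg01 => //; exact: bh.1.
Qed.

End WeakConvergence.

(** * Lower semicontinuity of mass, and the null complement of the support *)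

Section MassLimits.
Context {R : realType} {N n : nat}.
Implicit Types S T : current R N n.

Lemma finite_mass_setT S : finite_mass S -> (mass S setT < +oo)%E.
Proof. by rewrite mass_openE//; exact: openT. Qed.

(** A form on which [T] exceeds [r] is admissible for every [T_ i] too, and [T_ i w] tends to
    [T w]. *)
Lemma mass_lower_semicontinuous (T_ : nat -> current R N n) T :
  (forall w : test_form R N n, T_ i w @[i --> \oo] --> T w) ->
  forall O : set 'rV[R]_N, open O -> forall r : R, (r%:E < mass T O)%E ->
  \forall i \near \oo, (r%:E < mass (T_ i) O)%E.
Proof.
move=> wc O oO r; rewrite mass_openE// => /ereal_sup_gt[_ [w [w1 wO] <-]].
rewrite lte_fin => rTw; near=> i; rewrite mass_openE//.
apply: lt_le_trans (mass_open_ge (T_ i) w1 wO); rewrite lte_fin.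
near: i; apply: (cvgr_gt (T w)) => //; exact: wc.
Unshelve. all: by end_near. Qed.

Lemma open_compl_support T : open (~` current_support T).
Proof.
rewrite openE => x /= nTx.
have [U [oU Ux U0]] : exists U : set 'rV[R]_N, [/\ open U, U x &
    forall w : test_form R N n, form_support w `<=` U -> T w = 0].
  apply: contrapT => nU; apply: nTx => U oU Ux; apply: contrapT => nw.
  apply: nU; exists U; split=> // w wU; apply: contrapT => /eqP Tw.
  by apply: nw; exists w.
apply: filterS (open_nbhs_nbhs (conj oU Ux)) => y Uy /(_ U oU Uy)[w wU /eqP]; apply.
exact: U0.
Qed.

(** Each point off the support has an open neighbourhood of zero mass. Finitely many of them cover
    the compact support of a test form, and subadditivity concludes. *)
Lemma mass_compl_support T : mass T (~` current_support T) = 0%E.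
Proof.
rewrite mass_openE; last exact: open_compl_support.
apply/eqP; rewrite eq_le mass_open_ge0 andbT.
apply/ge_ereal_sup => _ [w [w1 wT] <-].
(* Points of the support receive the default [set0], so that the choice is total. *)
have /choice[U UP] (x : 'rV[R]_N) : exists U : set 'rV[R]_N, open U /\
    ((~` current_support T) x -> U x /\ mass_open T U = 0%E).
  have [Tx|/existsNP[U]] := pselect (current_support T x).
    by exists set0; split; [exact: open0|].
  move=> /not_implyP[oU /not_implyP[Ux nw]]; exists U; split=> // _; split=> //.
  apply/eqP; rewrite eq_le mass_open_ge0 andbT.
  apply/ge_ereal_sup => _ [v [_ vU] <-]; rewrite lee_fin.
  have [->//|Tv] := eqVneq (T v) 0; case: nw; by exists v.
have [D' D'T D'w] : finite_subset_cover (~` current_support T) U (form_support w).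
  have := @form_compact _ _ _ w; rewrite compact_cover; apply.
    by move=> x _; have [] := UP x.
  by move=> x /wT Tx; exists x => //; have [_ /(_ Tx)[]] := UP x.
apply: (@le_trans _ _ (mass_open T (\big[setU/set0]_(x <- D') U x))).
  by apply: mass_open_ge => //; rewrite -bigcup_fset.
have : {in (D' : seq _), forall x, mass_open T (U x) = 0%E}.
  by move=> x xD'; have [_] := UP x; case=> //; exact/set_mem/D'T.
elim: (D' : seq _) => [|x s ih] s0; first by rewrite big_nil mass_open0.
rewrite big_cons; apply: le_trans (mass_openU _ _ _) _.
- by have [] := UP x.
- rewrite -bigcup_seq; apply: bigcup_open => y _; by have [] := UP y.
- rewrite s0 ?mem_head// add0e; apply: ih => y ys.
  by rewrite s0// inE ys orbT.
Qed.

End MassLimits.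

(** * Stability of positive definiteness *)

Section QuadraticForms.
Context {R : realType} {k : nat}.
Implicit Types (M : 'M[R]_k) (a : 'rV[R]_k).

Definition quadratic M a : R := \sum_j \sum_l a 0 j * a 0 l * M j l.

Lemma quadraticZ M t a : quadratic M (t *: a) = t ^+ 2 * quadratic M a.
Proof.
rewrite /quadratic mulr_sumr; apply: eq_bigr => j _.
rewrite mulr_sumr; apply: eq_bigr => l _.
by rewrite !mxE; ring.
Qed.

Lemma quadraticBZ M M' c a :
  quadratic (c *: M - M') a = c * quadratic M a - quadratic M' a.
Proof.
rewrite /quadratic mulr_sumr -sumrB; apply: eq_bigr => j _.
rewrite mulr_sumr -sumrB; apply: eq_bigr => l _.
by rewrite !mxE; ring.
Qed.

Lemma quadratic_dist M M' a d : `|a| <= 1 -> (forall j l, `|M j l - M' j l| <= d) ->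
  `|quadratic M a - quadratic M' a| <= k%:R * (k%:R * d).
Proof.
move=> a1 MM'; have a1j j : `|a 0 j| <= 1.
  apply: le_trans a1; rewrite [leRHS]/Num.Def.normr/= mx_normrE.
  exact: (le_bigmax _ (fun i : 'I_1 * 'I_k => `|a i.1 i.2|) (0, j)).
have sumF (F : 'I_k -> R) e : (forall j, `|F j| <= e) -> `|\sum_j F j| <= k%:R * e.
  move=> Fe; apply: le_trans (ler_norm_sum _ _ _) _.
  apply: le_trans (ler_sum _ (fun j _ => Fe j)) _.
  by rewrite sumr_const card_ord mulr_natl.
rewrite /quadratic -sumrB; apply: (sumF) => j; rewrite -sumrB; apply: (sumF) => l.
rewrite -mulrBr !normrM -[leRHS]mul1r; apply: ler_pM => //.
by apply: mulr_ile1.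
Qed.

Lemma quadratic_continuous M : continuous (quadratic M).
Proof.
have sumF (F : 'I_k -> 'rV[R]_k -> R) : (forall j, continuous (F j)) ->
    continuous (fun a => \sum_j F j a).
  by move=> cF; apply: continuous_big => [|j _]; [exact: add_continuous|exact: cF].
apply: (sumF (fun j a => \sum_l a 0 j * a 0 l * M j l)) => j.
apply: (sumF (fun l a => a 0 j * a 0 l * M j l)) => l a.
apply: (@continuousM _ _ (fun a : 'rV[R]_k => a 0 j * a 0 l) (cst (M j l))).
  apply: (@continuousM _ _ (fun a : 'rV[R]_k => a 0 j) (fun a => a 0 l)).
    exact: coord_continuous.
  exact: coord_continuous.
exact: cst_continuous.
Qed.

(** The limit form has a positive minimum on the compact unit sphere, entrywise close matrices have
    uniformly close forms there, and homogeneity reaches all nonzero vectors. The threshold on [i]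
    is thus independent of [a]. *)
Lemma quadratic_pos_open (M_ : nat -> 'M[R]_k) M :
  (forall j l, M_ i j l @[i --> \oo] --> M j l) ->
  (forall a, a != 0 -> 0 < quadratic M a) ->
  \forall i \near \oo, forall a, a != 0 -> 0 < quadratic (M_ i) a.
Proof.
move=> Mc Mpos; pose K := [set a : 'rV[R]_k | `|a| = 1].
have unit a : a != 0 -> K (`|a|^-1 *: a).
  move=> a0; rewrite /K /= normrZ normfV normr_id mulVf// normr_eq0//.
(* The sphere is empty when k = 0, and then there is no nonzero [a] to test. *)
have [K0|K0] := eqVneq K set0.
  near=> i => a a0; have := unit a a0; by rewrite K0.
have cK : compact K.
  apply: bounded_closed_compact.
    by exists 1; split=> // x x1 a /= ->; exact: ltW.
  have cn : continuous (fun a : 'rV[R]_k => `|a|) by move=> a; exact: norm_continuous.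
  exact: (closed_comp (fun a _ => cn a) (@closed_eq _ 1)).
have [c cKin cmin] : exists2 c, c \in K & forall t, t \in K -> quadratic M c <= quadratic M t.
  apply: (compact_EVT_min _ cK); first exact/set0P.
  by apply: continuous_subspaceT => a; exact: quadratic_continuous.
set m := quadratic M c in cmin.
have m0 : 0 < m.
  apply: Mpos; rewrite -normr_eq0; have /set_mem -> := cKin; exact: oner_neq0.
(* Adding 1 keeps the divisor positive and makes k^2 d strictly less than [m]. *)
pose d := m / (k%:R * k%:R + 1).
have kk0 : 0 < k%:R * k%:R + 1 :> R by rewrite ltr_wpDl ?mulr_ge0.
have d0 : 0 < d by rewrite divr_gt0.
near=> i => a a0.
have Ka := unit a a0; set u := _ *: a in Ka.
have -> : a = `|a| *: u by rewrite scalerA divff ?scale1r// normr_eq0.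
rewrite quadraticZ mulr_gt0 ?exprn_gt0 ?normr_gt0//.
have : `|quadratic M u - quadratic (M_ i) u| <= k%:R * (k%:R * d).
  apply: quadratic_dist; first by rewrite Ka.
  move=> j l; rewrite ltW//; move: j l; near: i.
  apply: filter_forall => j; apply: filter_forall => l.
  by have /cvgrPdist_lt := Mc j l; apply.
have kd : k%:R * (k%:R * d) < m.
  rewrite mulrA -subr_gt0 (_ : m - _ = d)//.
  by rewrite -[m in LHS](divfK (lt0r_neq0 kk0)) -/d mulrDr mulr1 [d * _]mulrC addrC addKr.
have := cmin u (mem_set Ka); rewrite ler_norml => mu /andP[_].
by lra.
Unshelve. all: by end_near. Qed.

End QuadraticForms.

(** * Rayleigh quotients and Gram matrices *)

Section CompactlySupportedFunctions.
Context {R : realType} {N : nat}.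
Implicit Types (f g : 'rV[R]_N -> R^o) (C V : set 'rV[R]_N).

Lemma compact_bounded_continuous f C : compact C -> continuous f ->
  (forall x, f x != 0 -> C x) -> bounded_continuous (f : 'rV[R]_N -> R).
Proof.
move=> cC cf fC; split=> //.
have [M [_ hM]] : bounded_set ((f : 'rV[R]_N -> R) @` C).
  apply: compact_bounded; apply: continuous_compact => //.
  exact: continuous_subspaceT.
have M1 : M < `|M| + 1 by rewrite ltr_pwDr// ler_norm.
exists (`|M| + 1) => x; have [->|fx] := eqVneq (f x) 0.
  by rewrite normr0 addr_ge0.
by apply: (hM _ M1); exists x => //; exact: fC.
Qed.

Lemma eq_partial i f g V x : open V -> V x -> (forall y, V y -> f y = g y) ->
  partial i f x = partial i g x.
Proof.
move=> oV Vx fg; apply: near_eq_derive.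
by apply: filterS (open_nbhs_nbhs (conj oV Vx)) => y; exact: fg.
Qed.

Lemma partial_support i f C : closed C -> (forall x, f x != 0 -> C x) ->
  forall x, partial i f x != 0 -> C x.
Proof.
move=> cC fC x; apply: contra_neqP => nCx.
rewrite (@eq_partial i f (cst 0) (~` C))//; first exact: derive_cst.
  exact: closed_openC.
by move=> y nCy; apply/eqP; apply: contrapT => /negP/fC.
Qed.

Lemma smooth_comb (k : nat) (b : 'I_k -> 'rV[R]_N -> R^o) (c : 'I_k -> R) :
  (forall j, smooth (b j)) -> smooth (\sum_j c j *: b j).
Proof.
move=> sb; elim/big_rec: _ => [|j f _ sf]; first exact: smooth0.
exact: smooth_lin.
Qed.

Lemma partial_comb (k : nat) (b : 'I_k -> 'rV[R]_N -> R^o) (c : 'I_k -> R) i x :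
  (forall j, smooth (b j)) ->
  partial i (\sum_j c j *: b j) x = \sum_j c j * partial i (b j) x.
Proof.
move=> sb; rewrite /partial derive_sum; last first.
  by move=> j; apply: derivableZ; exact: smooth_derivable.
by apply: eq_bigr => j _; rewrite deriveZ//; exact: smooth_derivable.
Qed.

Lemma sum_scaleE (k : nat) (b : 'I_k -> 'rV[R]_N -> R^o) (c : 'I_k -> R) x :
  (\sum_j c j *: b j) x = \sum_j c j * b j x.
Proof. by rewrite fct_sumE. Qed.

End CompactlySupportedFunctions.

Section Rayleigh.
Context {R : realType} {N n : nat}.
Local Notation borelRN := (g_sigma_algebraType (@open 'rV[R]_N)).
Implicit Types (S T : current R N n) (f g : 'rV[R]_N -> R^o).

Definition sqr_integral S f : R := \int[mass_measure S]_x (f x ^+ 2).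

Definition energy S f : R := \int[mass_measure S]_x sqr_norm (gradient f x).

Lemma sqr_norm_gradient f x : sqr_norm (gradient f x) = \sum_i partial i f x ^+ 2.
Proof. by apply: eq_bigr => i _; rewrite mxE. Qed.

(** This makes both integrals of the Rayleigh quotient finite for every current of finite mass, so
    that real-valued integrals can be used. *)
Definition bounded_C1 f := bounded_continuous (f : 'rV[R]_N -> R) /\
  forall i, bounded_continuous (partial i f : 'rV[R]_N -> R).

Lemma bounded_continuous_sqr f : bounded_C1 f ->
  bounded_continuous (fun x => (f x : R) ^+ 2).
Proof. by move=> [bf _]; exact: (bounded_continuousM bf bf). Qed.

Lemma bounded_continuous_energy f : bounded_C1 f ->
  bounded_continuous (fun x => sqr_norm (gradient f x)).
Proof.
move=> [_ bf]; under eq_fun do rewrite sqr_norm_gradient.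
by apply: bounded_continuous_sum => i; exact: bounded_continuousM.
Qed.

Lemma sqr_integralE S f : finite_mass S -> bounded_C1 f ->
  mass_integral S (fun x => (`|f x| ^+ 2)%R) = (sqr_integral S f)%:E.
Proof.
move=> fS bf; rewrite /sqr_integral /Rintegral fineK.
  rewrite /mass_integral; apply: (@eq_integral _ _ _ (mass_measure S)) => x _.
  by rewrite real_normK// num_real.
apply: integrable_fin_num => //; apply: bounded_continuous_integrable.
  exact: finite_mass_setT.
exact: bounded_continuous_sqr.
Qed.

Lemma energyE S f : finite_mass S -> bounded_C1 f ->
  mass_integral S (fun x => sqr_norm (gradient f x)) = (energy S f)%:E.
Proof.
move=> fS bf; rewrite /energy /Rintegral fineK//.
apply: integrable_fin_num => //; apply: bounded_continuous_integrable.
  exact: finite_mass_setT.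
exact: bounded_continuous_energy.
Qed.

Lemma open_neq0 f : continuous f -> open [set x | f x != 0].
Proof. by move=> cf; exact: (open_comp (fun x _ => cf x) (@open_neq R^o 0)). Qed.

(** Shows that [rayleigh] takes its default value +oo exactly when the denominator vanishes: a
    nonnegative function of zero integral is zero almost everywhere. *)
Lemma sqr_integral_eq0 S f : finite_mass S -> bounded_C1 f ->
  sqr_integral S f = 0 <-> mass S [set x | f x != 0] = 0%E.
Proof.
move=> fS bf; have [[cf _] _] := bf.
have mf : measurable_fun [set: borelRN] (fun x : borelRN => (f x ^+ 2)%:E).
  by apply/measurable_EFinP; apply: (borel_continuous (bounded_continuous_sqr bf).1).
have mA : measurable ([set x | f x != 0] : set borelRN).
  by apply: borel_open; exact: open_neq0.
have E : (\int[mass_measure S]_x `|(f x ^+ 2)%:E|)%E = (sqr_integral S f)%:E.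
  rewrite -sqr_integralE//; apply: eq_integral => x _.
  by rewrite gee0_abs ?lee_fin ?sqr_ge0// real_normK// num_real.
have := @ae_eq_integral_abs _ _ _ (mass_measure S) setT measurableT _ mf.
rewrite E => -[ae1 ae2]; split=> [s0|m0].
  have [|A [mA' A0 sA]] := ae1 _; first by rewrite s0.
  apply/eqP; rewrite eq_le mass_ge0 andbT -A0; apply: le_mass => x /= fx.
  apply: sA => /= /(_ I) /eqP; rewrite eqe sqrf_eq0; exact/negP.
suff [] : (sqr_integral S f)%:E = 0%E by [].
apply: ae2; exists [set x | f x != 0]; split=> // x /= /not_implyP[_ fx].
by apply/eqP => f0; apply: fx; rewrite f0 expr0n.
Qed.

Lemma rayleigh_le S f (c : R) : finite_mass S -> bounded_C1 f ->
  0 < sqr_integral S f -> energy S f <= c * sqr_integral S f ->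
  (rayleigh S f <= c%:E)%E.
Proof.
move=> fS bf Q0 Dc; rewrite /rayleigh; case: asboolP => [/sqr_integral_eq0 f0|_].
  by rewrite f0// ltxx in Q0.
rewrite energyE// sqr_integralE// inver gt_eqF// -EFinM lee_fin.
by rewrite ler_pdivrMr.
Qed.

(* Only the values of f near the support of T matter. *)
Lemma rayleigh_lt T f g V (c : R) : finite_mass T -> smooth f -> bounded_C1 g ->
  open V -> current_support T `<=` V -> (forall x, V x -> f x = g x) ->
  (rayleigh T f < c%:E)%E ->
  0 < sqr_integral T g /\ energy T g < c * sqr_integral T g.
Proof.
move=> fT sf bg oV TV fg.
(* The complement of [V] misses the support of [T], so integrands agreeing on [V] have equal
   integrals. *)
have nullV : mass T (~` V) = 0%E.
  apply/eqP; rewrite eq_le mass_ge0 andbT -(mass_compl_support T).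
  exact/le_mass/subsetC.
have mV : measurable (~` V : set borelRN) by apply: (@measurableC _ borelRN); exact: borel_open.
have eqI (u v : 'rV[R]_N -> R) : continuous u -> continuous v ->
    (forall x, V x -> u x = v x) -> mass_integral T u = mass_integral T v.
  move=> cu cv uv; apply: (@ae_eq_integral _ _ _ (mass_measure T)) => //.
  - by apply/measurable_EFinP; exact: (borel_continuous cu).
  - by apply/measurable_EFinP; exact: (borel_continuous cv).
  - exists (~` V); split=> // x /= /not_implyP[_ ne] Vx; apply: ne.
    by rewrite uv.
have sqrc (h : 'rV[R]_N -> R^o) : continuous h -> continuous (fun x => `|h x| ^+ 2 : R).
  move=> ch x; under eq_fun do rewrite real_normK ?num_real// expr2.
  by apply: (@continuousM _ _ h h x); exact: ch.
have cf : continuous f by exact: smooth_continuous.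
have [[cg _] _] := bg.
have E1 : mass_integral T (fun x => (`|f x| ^+ 2)%R) = (sqr_integral T g)%:E.
  rewrite -sqr_integralE//; apply: eqI; [exact: sqrc|exact: sqrc|].
  by move=> x Vx; rewrite fg.
have E2 : mass_integral T (fun x => sqr_norm (gradient f x)) = (energy T g)%:E.
  rewrite -(energyE fT bg); apply: eqI.
  - under eq_fun do rewrite sqr_norm_gradient.
    apply: continuous_big => [|i _ x]; first exact: add_continuous.
    under eq_fun do rewrite expr2.
    have cp := smooth_continuous (smooth_partial i sf).
    by apply: (@continuousM _ _ (partial i f) (partial i f) x); exact: cp.
  - exact: (bounded_continuous_energy bg).1.
  - move=> x Vx; rewrite !sqr_norm_gradient; apply: eq_bigr => i _.
    by rewrite (eq_partial i oV Vx fg).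
rewrite /rayleigh; case: asboolP => [_|]; first by rewrite ltNge leey.
move=> f0; rewrite E1 E2.
have Q0 : 0 < sqr_integral T g.
  rewrite lt_neqAle Rintegral_ge0 ?andbT; last by move=> x _; exact: sqr_ge0.
  rewrite eq_sym; apply/eqP => /(sqr_integral_eq0 fT bg) g0; apply: f0.
  apply/eqP; rewrite eq_le mass_ge0 andbT.
  (* Were [g] null, [f] would be nonzero only on a null set, since it agrees with [g] on [V]; its
     quotient would then be +oo and not below [c]. *)
  apply: (@le_trans _ _ (mass T ([set x | g x != 0] `|` ~` V))).
    apply: le_mass => x /= fx; have [Vx|nVx] := pselect (V x); last by right.
    by left; rewrite /= -fg.
  by apply: le_trans (outer_measureU2 (mass T) _ _) _; rewrite /= g0 nullV adde0.
by rewrite inver gt_eqF// -EFinM lte_fin ltr_pdivrMr.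
Qed.

Variables (k : nat) (b : 'I_k -> 'rV[R]_N -> R^o).
Hypotheses (sb : forall j, smooth (b j)) (bb : forall j, bounded_C1 (b j)).

Definition gram S : 'M[R]_k :=
  \matrix_(j, l) \int[mass_measure S]_x (b j x * b l x).

Definition gradient_gram S : 'M[R]_k := \matrix_(j, l)
  \int[mass_measure S]_x (\sum_i partial i (b j) x * partial i (b l) x).

Lemma bounded_C1_comb (c : 'I_k -> R) : bounded_C1 (\sum_j c j *: b j).
Proof.
split.
  rewrite (_ : \sum_j _ = fun x => \sum_j c j * b j x); last first.
    by apply/funext => x; rewrite sum_scaleE.
  apply: bounded_continuous_sum => j; apply: bounded_continuousM.
    exact: bounded_continuous_cst.
  by have [] := bb j.
move=> i; rewrite (_ : partial i _ = fun x => \sum_j c j * partial i (b j) x).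
  apply: bounded_continuous_sum => j; apply: bounded_continuousM.
    exact: bounded_continuous_cst.
  by have [_] := bb j.
by apply/funext => x; rewrite partial_comb.
Qed.

Lemma Rintegral_quadratic S (a : 'rV[R]_k) (F : 'I_k -> 'I_k -> 'rV[R]_N -> R) :
  finite_mass S -> (forall j l, bounded_continuous (F j l)) ->
  \int[mass_measure S]_x (\sum_j \sum_l a 0 j * a 0 l * F j l x) =
  quadratic (\matrix_(j, l) \int[mass_measure S]_x F j l x) a.
Proof.
move=> /finite_mass_setT fS bF.
have bc c j l : bounded_continuous (fun x => c * F j l x).
  by apply: bounded_continuousM => //; exact: bounded_continuous_cst.
rewrite Rintegral_sum//; last by move=> j; exact: bounded_continuous_sum.
apply: eq_bigr => j _; rewrite Rintegral_sum//; apply: eq_bigr => l _.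
rewrite RintegralZl// ?mxE//; exact: bounded_continuous_integrable.
Qed.

Lemma sqr_integral_comb S (a : 'rV[R]_k) : finite_mass S ->
  sqr_integral S (\sum_j a 0 j *: b j) = quadratic (gram S) a.
Proof.
move=> fS; rewrite -Rintegral_quadratic//; last first.
  by move=> j l; apply: bounded_continuousM; [have [] := bb j|have [] := bb l].
apply: eq_Rintegral => x _; rewrite sum_scaleE expr2 big_distrlr /=.
by apply: eq_bigr => j _; apply: eq_bigr => l _; rewrite mulrACA.
Qed.

Lemma energy_comb S (a : 'rV[R]_k) : finite_mass S ->
  energy S (\sum_j a 0 j *: b j) = quadratic (gradient_gram S) a.
Proof.
move=> fS; rewrite -Rintegral_quadratic//; last first.
  move=> j l; apply: bounded_continuous_sum => i; apply: bounded_continuousM.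
    by have [_] := bb j.
  by have [_] := bb l.
apply: eq_Rintegral => x _; rewrite sqr_norm_gradient.
under eq_bigr do rewrite partial_comb// expr2 big_distrlr /=.
rewrite exchange_big; apply: eq_bigr => j _.
rewrite exchange_big; apply: eq_bigr => l _.
by rewrite mulr_sumr; apply: eq_bigr => i _; rewrite mulrACA.
Qed.

End Rayleigh.

(** * Comparison with real thresholds, and the limsup inequality *)

(** Allows the argument to run with a real [c] even for infinite eigenvalues: nothing is to be shown
    for [y = +oo], and for [y = -oo] a sufficiently small [c] rules out every larger [x]. *)
Lemma lee_real_gt {R : realType} (x y : \bar R) :
  (forall c : R, (y < c%:E)%E -> (x <= c%:E)%E) -> (x <= y)%E.
Proof.
move=> xc; case: y xc => [r| |] xc.
- by apply/lee_addgt0Pr => e e0; apply: xc; rewrite lte_fin ltrDl.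
- exact: leey.
- case: x xc => [x| |] xc //; last by have := xc 0 (ltNyr 0).
  by have := xc (x - 1) (ltNyr _); rewrite lee_fin lerDl oppr_ge0 ler10.
Qed.

(** The upper limit is an infimum of suprema over sets of the filter, one of which is the set where
    [u i <= c]. *)
Lemma limn_esup_le_near {R : realType} (u : (\bar R)^nat) (c : \bar R) :
  (\forall i \near \oo, (u i <= c)%E) -> (limn_esup u <= c)%E.
Proof.
move=> uc; apply: (@le_trans _ _ (ereal_sup (u @` [set i | (u i <= c)%E]))).
  by apply: ereal_inf_lbound; exists [set i | (u i <= c)%E].
by apply/ge_ereal_sup => _ [i /= ui <-].
Qed.

Lemma lambda_le {R : realType} {N n : nat} (k : nat) (S : current R N n)
    (b : 'I_k -> 'rV[R]_N -> R^o) (c : R) :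
  (forall j, smooth (b j)) ->
  (forall a : 'I_k -> R, \sum_j a j *: b j = 0 -> forall j, a j = 0) ->
  (forall a : 'rV[R]_k, a != 0 -> (rayleigh S (\sum_j a 0 j *: b j)%R <= c%:E)%E) ->
  (lambda k S <= c%:E)%E.
Proof.
move=> sb fb hb.
pose L := [set \sum_j a j *: b j | a in [set: 'I_k -> R]].
apply: (@le_trans _ _ (ereal_sup [set rayleigh S f | f in L `\ 0])).
  by apply: ereal_inf_lbound; exists L => //; exists b.
apply/ge_ereal_sup => _ [f [[a _ <-] f0] <-].
have -> : \sum_j a j *: b j = \sum_j (\row_j a j) 0 j *: b j.
  by apply: eq_bigr => j _; rewrite mxE.
apply: hb; apply: contra_notN f0 => /eqP a0 /=.
apply: big1 => j _; have := congr1 (fun v : 'rV_k => v 0 j) a0.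
by rewrite !mxE => ->; rewrite scale0r.
Qed.

Theorem theorem3 (R : realType) (N n : nat) (nN : (n <= N)%N)
  (T_ : nat -> current R N n) (T : current R N n)
  (supp_T_ : forall i, compact (current_support (T_ i)))
  (fin_T_ : forall i, finite_mass (T_ i))
  (supp_T : compact (current_support T))
  (fin_T : finite_mass T)
  (weak_cvg : forall w : test_form R N n, T_ i w @[i --> \oo] --> T w)
  (mass_cvg : mass (T_ i) setT @[i --> \oo] --> mass T setT)
  (k : nat) (k_gt0 : (0 < k)%N) :
  (limn_esup (fun i => lambda k (T_ i)) <= lambda k T)%E.
Proof.
apply: lee_real_gt => c /ereal_inf_lt[_ [L [b [sb fb LE]] <-] supc].
apply: limn_esup_le_near.
(* Smooth functions may be unbounded and the supports of the [T_ i] need not lie in one compact set;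
   the factor [chi] makes every integrand bounded. *)
have [chi [schi _ [V [oV TV chi1]] [C [cC _ chiC]]]] :=
  smooth_urysohn supp_T openT (@subsetT _ _).
pose g j : 'rV[R]_N -> R^o := fun x => chi x * b j x.
have sg j : smooth (g j) by exact: smoothM.
have gC j x : g j x != 0 -> C x.
  by move=> gx; apply: chiC; apply: contra_neq gx => chi0; rewrite /g chi0 mul0r.
have clC : closed C by exact: compact_closed.
have bg j : bounded_C1 (g j).
  split; first by apply: (compact_bounded_continuous cC); [exact: smooth_continuous|exact: gC].
  move=> i; apply: (compact_bounded_continuous cC).
    exact/smooth_continuous/smooth_partial.
  by apply: partial_support => //; exact: gC.
(* Together these say that the denominator is positive and the quotient is strictly below [c].
   Strictness is what survives the passage to [T_ i]. *)
have TQ (a : 'rV[R]_k) : a != 0 ->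
    0 < quadratic (gram g T) a /\
    0 < quadratic (c *: gram g T - gradient_gram g T) a.
  move=> a0; pose f := \sum_j a 0 j *: b j.
  have f0 : f != 0.
    apply: contra_neq a0 => /fb a0; apply/rowP => j; rewrite mxE; exact: a0.
  have fc : (rayleigh T f < c%:E)%E.
    apply: le_lt_trans supc; apply: ereal_sup_ubound; exists f => //.
    split; last exact/eqP.
    by rewrite LE; exists (fun j => a 0 j).
  have [|Q0] := rayleigh_lt fin_T (smooth_comb _ sb) (bounded_C1_comb sg bg (fun j => a 0 j))
    oV TV _ fc.
    move=> x Vx; rewrite !sum_scaleE; apply: eq_bigr => j _.
    by rewrite /g chi1// mul1r.
  move: Q0; rewrite sqr_integral_comb// energy_comb// => Q0 EQ; split=> //.
  by rewrite quadraticBZ subr_gt0.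
have mu_T i : (mass_measure (T_ i) setT < +oo)%E by exact: finite_mass_setT.
have muT : (mass_measure T setT < +oo)%E by exact: finite_mass_setT.
have tot : fine (mass_measure (T_ i) setT) @[i --> \oo] --> fine (mass_measure T setT).
  apply: fine_cvg; rewrite fineK//; rewrite ge0_fin_numE//; exact: mass_ge0.
have Ic (h : 'rV[R]_N -> R) : bounded_continuous h ->
    \int[mass_measure (T_ i)]_x h x @[i --> \oo] --> \int[mass_measure T]_x h x.
  by apply: Rintegral_cvg => //; exact: mass_lower_semicontinuous.
have Gc j l : gram g (T_ i) j l @[i --> \oo] --> gram g T j l.
  under eq_fun do rewrite mxE.
  by rewrite mxE; apply: Ic; apply: bounded_continuousM; [have [] := bg j|have [] := bg l].
have DGc j l : gradient_gram g (T_ i) j l @[i --> \oo] --> gradient_gram g T j l.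
  under eq_fun do rewrite mxE.
  rewrite mxE; apply: Ic; apply: bounded_continuous_sum => i.
  by apply: bounded_continuousM; [have [_] := bg j|have [_] := bg l].
(* Multiplying by [chi] could destroy independence. It does not, since a vanishing nontrivial
   combination would contradict positivity of the Gram form of [T]. *)
have g_free (a : 'I_k -> R) : \sum_j a j *: g j = 0 -> forall j, a j = 0.
  move=> ag0 j; apply: contrapT => /eqP aj0.
  have [] := TQ (\row_j a j).
    apply: contra_neq aj0 => /(congr1 (fun v : 'rV_k => v 0 j)).
    by rewrite !mxE.
  rewrite -sqr_integral_comb//.
  under eq_bigr do rewrite mxE.
  rewrite ag0 /sqr_integral; under eq_Rintegral do rewrite expr0n/=.
  by rewrite Rintegral_cst// mul0r ltxx.
near=> i.
apply: (lambda_le sg g_free) => a a0.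
have Qa : 0 < quadratic (gram g (T_ i)) a.
  (* The vector is generalized first, so that one threshold on [i] serves all [a] at once. *)
  move: a a0; near: i; apply: quadratic_pos_open => [j l|a a0]; first exact: Gc.
  by have [] := TQ a a0.
have Da : 0 < quadratic (c *: gram g (T_ i) - gradient_gram g (T_ i)) a.
  move: a a0 {Qa}; near: i.
  apply: (@quadratic_pos_open _ _ _ (c *: gram g T - gradient_gram g T)) => [j l|a a0].
    under eq_fun do rewrite 2!mxE [in X in _ + X]mxE.
    rewrite 2!mxE [in X in _ + X]mxE.
    by apply: cvgB; [apply: cvgMl_tmp; exact: Gc|exact: DGc].
  by have [] := TQ a a0.
rewrite quadraticBZ subr_gt0 in Da.
apply: rayleigh_le => //; first exact: bounded_C1_comb.
  by rewrite sqr_integral_comb.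
by rewrite sqr_integral_comb// energy_comb// ltW.
Unshelve. all: by end_near. Qed.
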